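(* Let $a\in(0,\infty)$, $1\le p\le q<\infty$, $0\le\alpha<d$, and let $(u,v)$ be a pair of weights on $\mathbb{R}^d$. If $$(u,v)\in\bigcup_{b'>a}A_{p,q,\alpha}^{b'},$$ then $M_\alpha^a$ is bounded from $L^p(\mathbb{R}^d,v,\gamma)$ to $L^{q,\infty}(\mathbb{R}^d,u,\gamma)$; that is, there exists a constant $C>0$ such that for all $f\in L^p(\mathbb{R}^d,v,\gamma)$ and all $\lambda>0$, $$\int_{\{x\in\mathbb{R}^d:\,M_\alpha^a(f)(x)>\lambda\}}u(x)\,d\gamma(x)\le\frac{C}{\lambda^q}\left(\int_{\mathbb{R}^d}|f(x)|^p\,v(x)\,d\gamma(x)\right)^{q/p}.$$
   Context: $\gamma$ is the Gaussian probability measure on $\mathbb{R}^d$, $d\gamma(x)=\pi^{-d/2}e^{-|x|^2}\,dx$, with $|\cdot|$ the Euclidean norm. A weight is a locally integrable function on $\mathbb{R}^d$ that is nonnegative $\gamma$-almost everywhere. $L^p(\mathbb{R}^d,v,\gamma)$ is the space of measurable $f$ with $\int_{\mathbb{R}^d}|f|^p v\,d\gamma<\infty$. All cubes $Q\subset\mathbb{R}^d$ have sides parallel to the coordinate axes; $c_Q$ is the center and $\ell(Q)$ the side length of $Q$. Put $m(x)=\min\{1,1/|x|\}$ (with $m(0)=1$), $\mathscr{Q}_a=\{Q\subset\mathbb{R}^d \text{ cube}:\ \ell(Q)\le a\,m(c_Q)\}$ and $\mathscr{Q}_a(x)=\{Q\in\mathscr{Q}_a: x\in Q\}$. Write $\dot\alpha=\alpha/d$.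 The local fractional maximal operator is $$M_\alpha^a(f)(x)=\sup_{Q\in\mathscr{Q}_a(x)}\frac{1}{\gamma(Q)^{1-\dot\alpha}}\int_Q|f(y)|\,d\gamma(y).$$ The local Muckenhoupt type class: for $p>1$, with $p'=p/(p-1)$, $(u,v)\in A_{p,q,\alpha}^{a}$ means $$\sup_{Q\in\mathscr{Q}_a}\gamma(Q)^{\dot\alpha+1/q-1/p}\left(\frac1{\gamma(Q)}\int_Q u\,d\gamma\right)^{1/q}\left(\frac1{\gamma(Q)}\int_Q v^{1-p'}\,d\gamma\right)^{1/p'}<\infty .$$ For $p=1$, $(u,v)\in A_{1,q,\alpha}^a$ means $$\sup_{Q\in\mathscr{Q}_a}\ \operatorname*{ess\,sup}_{x\in Q}\ \gamma(Q)^{\dot\alpha+1/q-1}\left(\frac1{\gamma(Q)}\int_Q u\,d\gamma\right)^{1/q}v(x)^{-1}<\infty,$$ the essential supremum being with respect to $\gamma$. Usual convention: $0\cdot\infty=0$. *)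

(* Defs.v *)
From HB Require Import structures.
From mathcomp Require Import all_boot all_order all_algebra.
From mathcomp Require Import all_classical all_reals all_analysis.
From mathcomp Require Import measurable_realfun ess_sup_inf.

Set Implicit Arguments.
Unset Strict Implicit.
Unset Printing Implicit Defensive.

Import Order.TTheory GRing.Theory Num.Theory.
Import numFieldNormedType.Exports.

Local Open Scope classical_set_scope.
Local Open Scope ring_scope.

(* R^d is d.-tuple R, with the product of the Borel sigma-algebras. *)

Section lebesgue_measure_tuple.
Context {R : realType}.
Local Open Scope ereal_scope.

Definition cons_pair d (z : R * d.-tuple R) : d.+1.-tuple R :=
  [tuple of z.1 :: z.2].

Lemma measurable_cons_pair d : measurable_fun setT (@cons_pair d).
Proof. by apply: measurable_cons. Qed.

Definition lebesgueS d (mu : {sigma_finite_measure set (d.-tuple R) -> \bar R})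
    : set (d.+1.-tuple R) -> \bar R :=
  pushforward (@lebesgue_measure R \x mu) (@cons_pair d).

Section lebesgueS_measure.
Variables (d : nat) (mu : {sigma_finite_measure set (d.-tuple R) -> \bar R}).

HB.instance Definition _ := Measure.copy (lebesgueS mu)
  (measure_function_pushforward__canonical__measure_function_Measure
    (@lebesgue_measure R \x mu) (@measurable_cons_pair d)).

Let lebesgueS_sigma_finite : sigma_finite setT (lebesgueS mu).
Proof.
have /sigma_finiteP[F [TF ndF Foo]] :=
  sigma_finiteT (@lebesgue_measure R : sigma_finite_measure (measurableTypeR R) R).
have /sigma_finiteP[G [TG ndG Goo]] := sigma_finiteT mu.
exists (fun n => [set t : d.+1.-tuple R |
    F n (thead t) /\ G n [tuple of behead t]]).
  rewrite predeqE => t; split => // _.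
  have [n _ Fn] : (\bigcup_k F k) (thead t) by rewrite -TF.
  have [k _ Gk] : (\bigcup_k G k) [tuple of behead t] by rewrite -TG.
  exists (maxn n k) => //; split.
    by move: (thead t) Fn; exact/subsetPset/ndF/leq_maxl.
  by move: [tuple of behead t] Gk; exact/subsetPset/ndG/leq_maxr.
move=> n; have [mF Fn] := Foo n; have [mG Gn] := Goo n; split.
  rewrite (_ : [set _ | _] = (fun t : d.+1.-tuple R => thead t) @^-1` F n `&`
    (fun t : d.+1.-tuple R => [tuple of behead t]) @^-1` G n)//.
  apply: measurableI; rewrite -[X in measurable X]setTI.
    by apply: (measurable_tnth ord0).
  exact: measurable_behead.
rewrite /lebesgueS /pushforward (_ : _ @^-1` _ = F n `*` G n).
  by rewrite product_measure1E// lte_mul_pinfty// ge0_fin_numE.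
rewrite predeqE => z; have bz : [tuple of behead (cons_pair z)] = z.2.
  exact/val_inj.
by rewrite /preimage/= bz theadE.
Qed.

HB.instance Definition _ :=
  Measure_isSigmaFinite.Build _ _ _ (lebesgueS mu) lebesgueS_sigma_finite.

End lebesgueS_measure.

Fixpoint lebesgue d : {sigma_finite_measure set (d.-tuple R) -> \bar R} :=
  if d is d'.+1 then lebesgueS (lebesgue d') else \d_([tuple] : 0.-tuple R).

End lebesgue_measure_tuple.
Arguments lebesgue R d : clear implicits.

Section gaussian_measure.
Context {R : realType}.

Definition euclid d (x : d.-tuple R) : R :=
  Num.sqrt (\sum_(i < d) tnth x i ^+ 2).

Lemma measurable_euclid d : measurable_fun setT (@euclid d).
Proof.
have msqrt : measurable_fun setT (@Num.sqrt R).
  by apply: continuous_measurable_fun => x; exact: sqrt_continuous.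
apply: (measurableT_comp msqrt).
apply: measurable_sum => i; apply: measurable_funX; exact: measurable_tnth.
Qed.

Definition gauss_density d (x : d.-tuple R) : R :=
  pi `^ (- (d%:R / 2)) * expR (- euclid x ^+ 2).

Definition gaussian d (A : set (d.-tuple R)) : \bar R :=
  (\int[lebesgue R d]_(x in A) (gauss_density x)%:E)%E.

Let measurable_gauss_density d : measurable_fun setT (@gauss_density d).
Proof.
apply: measurable_funM => //; apply: measurableT_comp => //.
by apply: measurableT_comp => //; apply: measurable_funX; exact: measurable_euclid.
Qed.

Let gauss_density_ge0 d (x : d.-tuple R) : 0 <= gauss_density x.
Proof. by rewrite mulr_ge0 ?powR_ge0 ?expR_ge0. Qed.

Section gaussian_is_measure.
Variable d : nat.

Let gaussian0 : @gaussian d set0 = 0%E.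
Proof. exact: integral_set0. Qed.

Let gaussian_ge0 A : (0 <= @gaussian d A)%E.
Proof. by apply: integral_ge0 => x _; rewrite lee_fin. Qed.

Let gaussian_sigma_additive : semi_sigma_additive (@gaussian d).
Proof.
apply: semi_sigma_additive_nng_induced; last by move=> x; rewrite lee_fin.
by apply/measurable_EFinP; exact: measurable_gauss_density.
Qed.

HB.instance Definition _ := isMeasure.Build _ _ _ (@gaussian d)
  gaussian0 gaussian_ge0 gaussian_sigma_additive.

End gaussian_is_measure.

End gaussian_measure.
Arguments gaussian R d : clear implicits.

Section local_fractional_maximal.
Context {R : realType} {d : nat}.
Implicit Types (x c : d.-tuple R) (f u v w : d.-tuple R -> R).
Implicit Types (a l p q alpha : R).
Local Notation gamma := (gaussian R d).

(* Closed cube with center c and side length l. For closed cubes the maximal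
   function is the largest, and since faces are null sets the Muckenhoupt
   conditions are the same for open cubes. *)
Definition cube c l : set (d.-tuple R) :=
  [set x | forall i, `|tnth x i - tnth c i| <= l / 2].

Lemma measurable_cube c l : measurable (cube c l).
Proof.
rewrite (_ : cube c l = \bigcap_(i in [set: 'I_d])
    ((@tnth d R)^~ i @^-1` `[tnth c i - l / 2, tnth c i + l / 2])); last first.
  rewrite predeqE => x; split => [xQ i _|xQ i].
    by rewrite /= in_itv/= -ler_distl; exact: xQ.
  by have := xQ i Logic.I; rewrite /= in_itv/= -ler_distl.
apply: fin_bigcap_measurable => // i _.
by rewrite -[X in measurable X]setTI; exact: measurable_tnth.
Qed.

(* The inverse of 0 in R is 0, hence the separate case. *)
Definition critical_scale x : R := if euclid x == 0 then 1 else Num.min 1 (euclid x)^-1.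

Definition local_cube a c l : Prop := 0 < l <= a * critical_scale c.

Definition locally_integrable_tuple w : Prop :=
  measurable_fun setT w /\
  forall K : set 'rV[R]_d, compact K ->
    (lebesgue R d).-integrable [set x | K (\row_i tnth x i)] (EFin \o w).

Definition weight w : Prop :=
  locally_integrable_tuple w /\ {ae gamma, forall x, 0 <= w x}.

Local Open Scope ereal_scope.

Definition weighted_Lp p v f : Prop :=
  measurable_fun setT f /\
  \int[gamma]_x ((`|f x| `^ p)%R * v x)%:E < +oo.

(* The superlevel sets of maximal are unions of nondegenerate closed cubes:
   Lebesgue measurable, possibly not Borel. For a nonnegative integrand \int is
   the supremum over Borel simple functions below it, so over such a set it is
   the integral for the completion of gamma. *)
Definition maximal a alpha f x : \bar R :=
  ereal_sup [set s | exists c l, [/\ local_cube a c l, cube c l x &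
    s = (gamma (cube c l) `^ (1 - alpha / d%:R))^-1 *
        \int[gamma]_(y in cube c l) `|f y|%:E ]].

Definition average (Q : set (d.-tuple R)) (g : d.-tuple R -> \bar R) : \bar R :=
  (gamma Q)^-1 * \int[gamma]_(x in Q) g x.

(* Negative powers of v are taken in the extended reals, through its inverse,
   because poweR maps 0 to 0 for every nonzero exponent: here v^-1 and v^(1-p')
   are +oo where v vanishes. The product of 0 and +oo is 0 in \bar R. *)
Definition muckenhoupt_gt1 p q alpha a u v : Prop :=
  let p' := (p / (p - 1))%R in
  ereal_sup [set s | exists c l, local_cube a c l /\
    s = gamma (cube c l) `^ (alpha / d%:R + q^-1 - p^-1) *
        average (cube c l) (fun x => (u x)%:E) `^ q^-1 *
        average (cube c l) (fun x => (v x)%:E^-1 `^ (p' - 1)) `^ p'^-1] < +oo.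

Definition muckenhoupt_1 q alpha a u v : Prop :=
  ereal_sup [set s | exists c l, local_cube a c l /\
    s = ess_sup (mrestr gamma (measurable_cube c l)) (fun x =>
        gamma (cube c l) `^ (alpha / d%:R + q^-1 - 1) *
        average (cube c l) (fun y => (u y)%:E) `^ q^-1 *
        (v x)%:E^-1)] < +oo.

Definition muckenhoupt p q alpha a u v : Prop :=
  if p == 1%R then muckenhoupt_1 q alpha a u v
  else muckenhoupt_gt1 p q alpha a u v.

End local_fractional_maximal.

(* Main.v *)
Require Import Defs.
From mathcomp Require Import all_boot all_order all_algebra.
From mathcomp Require Import all_classical all_reals all_analysis.
From mathcomp Require Import measurable_realfun ess_sup_inf.
From mathcomp Require Import ring lra zify.

(** Hölder's inequality (for p = 1, the definition of the essential supremum)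
turns the Muckenhoupt condition into an estimate on single cubes: for every
admissible cube Q of parameter b and every f,
  gamma(Q)^(alpha/d - 1) u(Q)^(1/q) int_Q |f| <= K (int_Q |f|^p v)^(1/p),
where u(Q) is the integral of u over Q ([testing]).  Applied to f cut off to a
part G of Q, it bounds u(Q) by a multiple of
lambda^-q (int_G |f|^p v)^(q/p) as soon as int_G |f| is at least a fixed
multiple of lambda gamma(Q)^(1 - alpha/d).  On admissible cubes the Gaussian
density is constant up to a bounded factor, so gamma is doubling there, and a
large average over a small cube yields such a bound for a bigger admissible
cube around it ([testing_dilate]).  Because q/p >= 1, the bounds can be summed
over a family of cubes whose sets G are disjoint ([integral_packing]).  It
remains to cover the superlevel set by finitely many such families.

The cubes whose side is at most a small multiple eps of the critical scale can
be enlarged by a fixed factor.  Each of them is covered by 2^d dyadic cells of comparable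
side, one of which carries a large part of the integral of |f|; the cube lies
in the triple of that cell, and the triple is admissible for b.  The maximal
cells among those obtained are disjoint, and their triples still cover
([small_cubes]).

The other admissible cubes of parameter a have room only for a dilation by b/a,
too little for a covering argument of Vitali type; but their sides are
comparable to the critical scale, which varies slowly, so that the cubes that
meet a given point all have about the same size.  Cut the space into cells so
small that a cell which meets Q is contained in (b/a)Q, and choose one such
cube Q for each cell.  The chosen cubes overlap, but the cells can be painted
with finitely many colours in such a way that the cubes chosen for cells of one
colour are disjoint ([large_cubes]).

Both coverings are countable unions of measurable sets that contain the
superlevel set, so its own measurability is never at stake
([le_integral_superset]). *)

Set Implicit Arguments.
Unset Strict Implicit.
Unset Printing Implicit Defensive.

Import Order.TTheory GRing.Theory Num.Theory.
Import numFieldNormedType.Exports.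

Local Open Scope classical_set_scope.
Local Open Scope ring_scope.

(** * Geometry of admissible cubes, and their Gaussian measure *)

Section geometry.
Context {R : realType} {d : nat}.
Implicit Types (x y c : d.-tuple R) (a b l r : R).

(** The inverse of the critical scale.  It is never zero, and turns the
admissibility of a cube into the product inequality of [local_cubeE]. *)
Definition scale x : R := Num.max 1 (euclid x).

Lemma scale_ge1 x : 1 <= scale x.
Proof. by rewrite le_max lexx. Qed.

Lemma scale_gt0 x : 0 < scale x.
Proof. exact: lt_le_trans (scale_ge1 x). Qed.

Lemma euclid_ge0 x : 0 <= euclid x.
Proof. exact: sqrtr_ge0. Qed.

Lemma sqr_euclid x : euclid x ^+ 2 = \sum_(i < d) tnth x i ^+ 2.
Proof. by rewrite sqr_sqrtr// sumr_ge0// => i _; rewrite sqr_ge0. Qed.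

Lemma critical_scaleE x : critical_scale x = (scale x)^-1.
Proof.
rewrite /critical_scale /scale; case: ifPn => [/eqP ->|e0].
  by rewrite max_l// invr1.
have ep : 0 < euclid x by rewrite lt_def e0 euclid_ge0.
case: (leP 1 (euclid x)) => e1.
  by rewrite min_r// invf_le1.
by rewrite min_l ?invr1// invf_ge1// ltW.
Qed.

Lemma local_cubeE a c l : local_cube a c l <-> 0 < l /\ l * scale c <= a.
Proof.
rewrite /local_cube critical_scaleE; split.
  by move=> /andP[l0]; rewrite ler_pdivlMr ?scale_gt0// => ->.
by move=> [-> h]; rewrite ler_pdivlMr ?scale_gt0.
Qed.

Lemma local_cube_side a c l : local_cube a c l -> l <= a.
Proof.
move=> /local_cubeE[l0 la]; apply: le_trans la.
by rewrite ler_peMr ?scale_ge1// ltW.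
Qed.

Lemma sqr_euclid_near x y r : (forall i, `|tnth x i - tnth y i| <= r) ->
  euclid x ^+ 2 <= 2 * euclid y ^+ 2 + 2 * d%:R * r ^+ 2.
Proof.
move=> xy; rewrite !sqr_euclid mulr_sumr.
rewrite (_ : 2 * d%:R * r ^+ 2 = \sum_(i < d) 2 * r ^+ 2); last first.
  by rewrite sumr_const card_ord -mulr_natl; ring.
rewrite -big_split/=; apply: ler_sum => i _.
have := xy i; rewrite ler_norml => /andP[h1 h2].
set s := tnth x i in h1 h2 *; set t := tnth y i in h1 h2 *.
have : (s - t) ^+ 2 <= r ^+ 2 by nra.
have := sqr_ge0 (s - 2 * t); nra.
Qed.

(** The critical scale varies slowly: it changes by a bounded factor over a
bounded distance.  Comparing squares avoids the triangle inequality for the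
Euclidean norm, at the price of a cruder factor. *)
Lemma scale_near x y r : (forall i, `|tnth x i - tnth y i| <= r) ->
  scale x <= (2 + 2 * d%:R * r ^+ 2) * scale y.
Proof.
move=> xy; set B := 2 + _.
have d0 : 0 <= d%:R * r ^+ 2 by rewrite mulr_ge0 ?sqr_ge0.
have B1 : 1 <= B by rewrite /B; nra.
have sy := scale_ge1 y.
have ys : euclid y <= scale y by rewrite le_max lexx orbT.
rewrite [scale x]/scale ge_max; apply/andP; split; first nra.
rewrite -(@ler_pXn2r _ 2)// ?nnegrE ?euclid_ge0//; last nra.
apply: (le_trans (sqr_euclid_near xy)).
have y2 : euclid y ^+ 2 <= scale y ^+ 2.
  by rewrite ler_pXn2r// ?nnegrE ?euclid_ge0// ltW// scale_gt0.
have s2 : 1 <= scale y ^+ 2 by rewrite exprn_ege1.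
rewrite exprMn; set s := scale y ^+ 2 in y2 s2 *.
have : B * s <= B ^+ 2 * s by apply: ler_wpM2r; nra.
rewrite {1}/B; nra.
Qed.

(** A bound for the variation of the exponent |x|^2 of the Gaussian density over
an admissible cube; see [sqr_euclid_osc]. *)
Definition osc b : R := d%:R * (b ^+ 2 + b).

(** Admissibility says that l and l |c| are both at most b, and these are the two
terms in |x|^2 - |c|^2 = sum of (x_i - c_i)^2 + 2 (x_i - c_i) c_i. *)
Lemma sqr_euclid_osc b c l x : local_cube b c l -> cube c l x ->
  `|euclid x ^+ 2 - euclid c ^+ 2| <= osc b.
Proof.
move=> lc xQ; have [l0 lb] := (local_cubeE _ _ _).1 lc.
have lb1 := local_cube_side lc.
rewrite !sqr_euclid -sumrB; apply: (le_trans (ler_norm_sum _ _ _)).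
rewrite (_ : osc b = \sum_(i < d) (b ^+ 2 + b)); last first.
  by rewrite sumr_const card_ord -mulr_natl.
apply: ler_sum => i _; have := xQ i.
have ci : `|tnth c i| <= euclid c.
  rewrite -(@ler_pXn2r _ 2)// ?nnegrE ?euclid_ge0// sqr_euclid real_normK ?num_real//.
  by rewrite (bigD1 i)//= lerDl sumr_ge0// => j _; rewrite sqr_ge0.
have ec : l * euclid c <= b.
  by apply: le_trans lb; rewrite ler_pM2l// le_max lexx orbT.
have lc' : l * `|tnth c i| <= b by apply: le_trans ec; rewrite ler_pM2l.
rewrite (_ : _ ^+ 2 - _ = (tnth x i - tnth c i) ^+ 2
   + 2 * ((tnth x i - tnth c i) * tnth c i)); last by ring.
move: ci lc'; set t := tnth c i; set s := _ - t => ci lc' sl.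
apply: (le_trans (ler_normD _ _)); rewrite normrX !normrM (ger0_norm (ler0n _ _)).
have s0 := normr_ge0 s; have t0 := normr_ge0 t.
have : `|s| * `|t| <= l / 2 * `|t| by apply: ler_wpM2r.
have : `|s| ^+ 2 <= b ^+ 2 by rewrite ler_pXn2r ?nnegrE//; lra.
by nra.
Qed.

Lemma subset_cube c l c' l' :
  (forall i, `|tnth c i - tnth c' i| <= (l' - l) / 2) -> cube c l `<=` cube c' l'.
Proof.
move=> h x xQ i; have := h i; have := xQ i; rewrite !ler_norml.
by move=> /andP[? ?] /andP[? ?]; lra.
Qed.

End geometry.
Arguments osc {R} d b.

Section gaussian_cube.
Context {R : realType}.
Local Open Scope ereal_scope.

(** By induction on the dimension: the measure on d.+1-tuples is the image of a
product measure, and the preimage of a cube is an interval times a cube. *)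
Lemma lebesgue_cube d (c : d.-tuple R) (l : R) : (0 <= l)%R ->
  lebesgue R d (cube c l) = (l ^+ d)%:E.
Proof.
move=> l0; elim: d c => [|d IH] c.
  rewrite /= diracE mem_set// => -[]//.
rewrite /= /lebesgueS /pushforward.
rewrite (_ : _ @^-1` _ = `[(tnth c ord0 - l / 2)%R, (tnth c ord0 + l / 2)%R]%classic `*`
    cube [tuple of behead c] l); last first.
  apply/seteqP; split => -[x y]/=.
    move=> h; split.
      by have := h ord0; rewrite (tnth_nth 0%R)/= in_itv/= -ler_distl.
    move=> i; have := h (lift ord0 i).
    by rewrite !(tnth_nth 0%R)/= nth_behead.
  move=> [h1 h2] i; case: (unliftP ord0 i) => [j|] ->.
    by have := h2 j; rewrite !(tnth_nth 0%R)/= nth_behead.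
  by move: h1; rewrite (tnth_nth 0%R)/= in_itv/= -ler_distl.
rewrite product_measure1E//; last exact: measurable_cube.
rewrite [X in _ * X]IH.
transitivity (l%:E * (l ^+ d)%:E); last by rewrite -EFinM -exprS.
congr (_ * _).
rewrite [LHS]lebesgue_measure_itv/= lte_fin.
move: l0; rewrite le_eqVlt => /predU1P[<-|l0].
  by rewrite mul0r addr0 subr0 ltxx.
rewrite ifT; last lra.
rewrite -EFinD; congr EFin; lra.
Qed.

Context {d : nat}.
Implicit Types (c : d.-tuple R) (b l : R).
Local Notation gamma := (gaussian R d).

Lemma measurable_gauss_density : measurable_fun setT (@gauss_density R d).
Proof.
apply: measurable_funM => //; apply: measurableT_comp => //.
by apply: measurableT_comp => //; apply: measurable_funX; exact: measurable_euclid.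
Qed.

Lemma gauss_density_gt0 (c : d.-tuple R) : (0 < gauss_density c)%R.
Proof. by rewrite mulr_gt0 ?expR_gt0// powR_gt0// pi_gt0. Qed.

(** On an admissible cube the Gaussian measure is the Lebesgue measure up to a
bounded factor. *)
Lemma gaussian_local_bounds b c l (A : set (d.-tuple R)) :
  local_cube b c l -> measurable A -> A `<=` cube c l ->
  (gauss_density c * expR (- osc d b))%:E * lebesgue R d A <= gamma A /\
  gamma A <= (gauss_density c * expR (osc d b))%:E * lebesgue R d A.
Proof.
move=> lc mA AQ; rewrite /gaussian.
have k0 : (0 <= pi `^ (- (d%:R / 2)) :> R)%R by exact: powR_ge0.
have pk0 := gauss_density_gt0 c.
have mg : measurable_fun A (EFin \o @gauss_density R d).
  by apply/measurable_EFinP; apply: measurable_funTS; exact: measurable_gauss_density.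
split.
- rewrite -integral_cst//; apply: ge0_le_integral => //.
  + by move=> x _; rewrite lee_fin mulr_ge0 ?expR_ge0// ltW.
  + move=> x Ax; rewrite lee_fin /gauss_density -mulrA -expRD.
    rewrite ler_wpM2l// ler_expR.
    have := sqr_euclid_osc lc (AQ _ Ax); rewrite ler_norml => /andP[? ?]; lra.
- rewrite -integral_cst//; apply: ge0_le_integral => //.
  + by move=> x _; rewrite lee_fin /gauss_density mulr_ge0 ?expR_ge0.
  + move=> x Ax; rewrite lee_fin /gauss_density -mulrA -expRD.
    rewrite ler_wpM2l// ler_expR.
    have := sqr_euclid_osc lc (AQ _ Ax); rewrite ler_norml => /andP[? ?]; lra.
Qed.

Lemma gaussian_cubeE b c l : local_cube b c l ->
  exists2 g : R, (0 < g)%R & gamma (cube c l) = g%:E.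
Proof.
move=> lc; have [l0 _] := (local_cubeE _ _ _).1 lc.
have [] := gaussian_local_bounds lc (measurable_cube c l) (@subset_refl _ _).
rewrite lebesgue_cube ?(ltW l0)// -!EFinM => lo hi.
have gf : gamma (cube c l) \is a fin_num.
  by rewrite ge0_fin_numE// (le_lt_trans hi)// ltry.
exists (fine (gamma (cube c l))); last by rewrite fineK.
rewrite -lte_fin fineK//; apply: lt_le_trans lo; rewrite lte_fin.
apply: mulr_gt0; last exact: exprn_gt0.
by apply: mulr_gt0; [exact: gauss_density_gt0|exact: expR_gt0].
Qed.

Definition doubling_cst b k : R := expR (2 * osc d b) * k ^+ d.

(** Both measures are compared with the density at the center of the bigger cube. *)
Lemma gaussian_doubling b k c l c' l' : local_cube b c' l' -> (0 < l)%R ->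
  cube c l `<=` cube c' l' -> (l' <= k * l)%R ->
  gamma (cube c' l') <= (doubling_cst b k)%:E * gamma (cube c l).
Proof.
move=> lc l0 QQ lk; have [l'0 _] := (local_cubeE _ _ _).1 lc.
have k0 : (0 < k)%R by rewrite -(pmulr_lgt0 _ l0) (lt_le_trans l'0).
have [_] := gaussian_local_bounds lc (measurable_cube c' l') (@subset_refl _ _).
have [+ _] := gaussian_local_bounds lc (measurable_cube c l) QQ.
rewrite (lebesgue_cube _ (ltW l0)) (lebesgue_cube _ (ltW l'0)) => lo hi.
apply: (le_trans hi).
apply: (@le_trans _ _ ((doubling_cst b k)%:E *
    ((gauss_density c' * expR (- osc d b))%:E * (l ^+ d)%:E))); last first.
  by rewrite lee_pmul2l// lte_fin mulr_gt0 ?expR_gt0 ?exprn_gt0.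
rewrite -!EFinM lee_fin /doubling_cst mulr2n mulrDl !mul1r expRD.
have e0 : (0 < expR (osc d b) :> R)%R by exact: expR_gt0.
have eN : (expR (osc d b) * expR (- osc d b) = 1 :> R)%R.
  by rewrite -expRD subrr expR0.
rewrite [leRHS](_ : _ = gauss_density c' * expR (osc d b) *
   (expR (osc d b) * expR (- osc d b)) * (k ^+ d * l ^+ d))%R; last by ring.
rewrite eN mulr1 -exprMn ler_pM2l; last exact: mulr_gt0 (gauss_density_gt0 c') e0.
by rewrite lerXn2r// ?nnegrE ?ltW// mulr_gt0.
Qed.

End gaussian_cube.
Arguments doubling_cst {R} d b k.

(** * Hölder's inequality with a weight that may vanish *)

Section weighted_hoelder.
Context {dT} {T : measurableType dT} {R : realType}.
Variable mu : {measure set T -> \bar R}.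
Local Open Scope ereal_scope.

(** For negative t both powers are 1, because ln takes the value 0 there; the
identity thus gives the measurability of the inverse powers of a weight that is
nonnegative only almost everywhere. *)
Lemma poweR_inveE (r t : R) : r != 0%R ->
  t%:E^-1 `^ r = if t == 0%R then +oo else (t `^ (- r))%:E.
Proof.
move=> r0; rewrite inver; case: ifPn => [_|t0]; first by rewrite poweRyr.
rewrite poweR_EFin powRN; congr EFin.
rewrite /powR invr_eq0 (negbTE t0) -expRN; congr expR.
have [t_gt0|t_le0] := ltP 0%R t; first by rewrite lnV ?posrE// mulrN.
by rewrite !ln0 ?mulr0 ?oppr0// invr_le0.
Qed.

Lemma measurable_poweR_inve (r : R) (v : T -> R) : r != 0%R ->
  measurable_fun setT v -> measurable_fun setT (fun x => (v x)%:E^-1 `^ r).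
Proof.
move=> r0 mv; under eq_fun do rewrite poweR_inveE//.
apply: measurable_fun_ifT => //; first exact: measurable_fun_eqr.
apply: measurableT_comp => //.
exact: measurableT_comp (measurable_powR _) mv.
Qed.

(** Hölder's inequality for |f| v^(1/p) and v^(-1/p).  Where v vanishes the
product of the two is not |f|, but the integral on the right would be infinite
if v vanished on a set of positive measure. *)
Lemma weighted_hoelder (p : R) (Q : set T) (f v : T -> R) :
  let p' := (p / (p - 1))%R in
  (1 < p)%R -> measurable Q -> measurable_fun setT f -> measurable_fun setT v ->
  (forall x, (0 <= v x)%R) ->
  \int[mu]_(x in Q) ((v x)%:E^-1 `^ (p' - 1)) < +oo ->
  \int[mu]_(x in Q) `|f x|%:E <=
    (\int[mu]_(x in Q) (`|f x| `^ p * v x)%:E) `^ p^-1 *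
    (\int[mu]_(x in Q) ((v x)%:E^-1 `^ (p' - 1))) `^ p'^-1.
Proof.
move=> p' p1 mQ mf mv v0 Soo.
have p0 : (0 < p)%R by lra.
have p10 : (0 < p - 1)%R by lra.
have p'0 : (0 < p')%R by rewrite divr_gt0.
have p'1 : (p' - 1 = (p - 1)^-1)%R by rewrite /p'; field; lra.
have r0 : (0 < p' - 1)%R by rewrite p'1 invr_gt0.
have pp' : (p^-1 + p'^-1 = 1)%R by rewrite /p'; field; lra.
have e1 : (- (p' - 1) * p'^-1 = - p^-1)%R by rewrite /p'; field; lra.
have mW := measurable_poweR_inve (lt0r_neq0 r0) mv.
have v_gt0 : {ae mu, forall x, Q x -> (0 < v x)%R}.
  have : {ae mu, forall x, Q x -> (v x)%:E^-1 `^ (p' - 1) \is a fin_num}.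
    apply: integrable_ae => //; apply/integrableP; split.
      exact: measurable_funTS.
    by under eq_integral do rewrite gee0_abs ?poweR_ge0//.
  apply: filterS => x h Qx; move: (h Qx).
  rewrite poweR_inveE ?lt0r_neq0//; case: ifPn => // vx _.
  by rewrite lt_def vx v0.
pose h x : R := (v x `^ (- (p' - 1)))%R.
have mpow (g : T -> R) s : measurable_fun setT g -> measurable_fun setT (fun x => g x `^ s)%R.
  by move=> mg; exact: measurableT_comp (measurable_powR _) mg.
have mh : measurable_fun setT h by exact: mpow.
pose F x := (`|f x| * v x `^ p^-1 * \1_Q x)%R.
pose G x := (h x `^ p'^-1 * \1_Q x)%R.
have mI : measurable_fun setT (\1_Q : T -> R) by exact/measurable_indicP.
have mnf : measurable_fun setT (fun x => `|f x|)%R by exact: measurableT_comp.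
have mF : measurable_fun setT F.
  by apply: measurable_funM => //; apply: measurable_funM => //; exact: mpow.
have mG : measurable_fun setT G by apply: measurable_funM => //; exact: mpow.
have := hoelder mu mF mG p0 p'0 pp'.
rewrite unlock /= invr1 poweRe1; last first.
  by apply: integral_ge0 => x _; rewrite lee_fin powR_ge0.
have -> : \int[mu]_x (`|F x * G x| `^ 1)%:E = \int[mu]_(x in Q) `|f x|%:E.
  rewrite [RHS]integral_mkcond; apply: ae_eq_integral => //.
  - apply/measurable_EFinP; apply: mpow; apply: measurableT_comp => //.
    exact: measurable_funM.
  - apply/(measurable_restrictT _ _).1 => //; apply: measurable_funTS.
    exact/measurable_EFinP.
  apply: filterS v_gt0 => x vx _; rewrite powRr1// patchE /F /G indicE.
  case: ifPn => [/set_mem Qx|xQ] /=; last by rewrite !mulr0 normr0.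
  rewrite !mulr1 /h -powRrM e1 -mulrA -powRD; last by rewrite (gt_eqF (vx Qx)) implybT.
  by rewrite subrr powRr0 mulr1 normr_id.
have -> : \int[mu]_x (`|F x| `^ p)%:E = \int[mu]_(x in Q) (`|f x| `^ p * v x)%:E.
  rewrite [RHS]integral_mkcond; apply: eq_integral => x _; rewrite patchE /F indicE.
  case: ifPn => [/set_mem Qx|xQ] /=; last first.
    by rewrite !mulr0 normr0 powR0// lt0r_neq0.
  rewrite mulr1 ger0_norm ?mulr_ge0 ?powR_ge0// powRM ?powR_ge0// -powRrM mulVf ?lt0r_neq0//.
  by rewrite powRr1.
have -> : \int[mu]_x (`|G x| `^ p')%:E = \int[mu]_(x in Q) (h x)%:E.
  rewrite [RHS]integral_mkcond; apply: eq_integral => x _; rewrite patchE /G indicE.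
  case: ifPn => [/set_mem Qx|xQ] /=; last first.
    by rewrite !mulr0 normr0 powR0// lt0r_neq0.
  rewrite mulr1 ger0_norm ?mulr_ge0 ?powR_ge0// -powRrM mulVf ?lt0r_neq0//.
  by rewrite powRr1// powR_ge0.
move=> H; apply: (le_trans H); rewrite lee_wpmul2l ?poweR_ge0//.
have hS : \int[mu]_(x in Q) (h x)%:E <= \int[mu]_(x in Q) ((v x)%:E^-1 `^ (p' - 1)).
  apply: ge0_le_integral => //.
  - by move=> x _; rewrite lee_fin powR_ge0.
  - by apply: measurable_funTS; exact/measurable_EFinP.
  - exact: measurable_funTS.
  - move=> x _; rewrite poweR_inveE ?lt0r_neq0//; case: ifPn => // _; exact: leey.
apply: gt0_ler_poweR => //; rewrite ?invr_ge0 ?(ltW p'0)// in_itv/= leey andbT.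
- by apply: integral_ge0 => x _; rewrite lee_fin powR_ge0.
- by apply: integral_ge0 => x _; rewrite poweR_ge0.
Qed.

End weighted_hoelder.

(** * From the Muckenhoupt condition to estimates on single cubes *)

Section muckenhoupt_testing.
Context {R : realType} {d : nat}.
Implicit Types (f u v : d.-tuple R -> R) (c : d.-tuple R) (a b l p q alpha K : R).
Local Notation gamma := (gaussian R d).
Local Open Scope ereal_scope.

(** The form in which the Muckenhoupt condition enters the proof, the same for
p = 1 and p > 1. *)
Definition testing K p q alpha b u v : Prop := forall c l f,
  local_cube b c l -> measurable_fun setT f ->
  gamma (cube c l) `^ (alpha / d%:R - 1) *
    (\int[gamma]_(x in cube c l) (u x)%:E) `^ q^-1 *
    \int[gamma]_(x in cube c l) `|f x|%:E <=
  K%:E * (\int[gamma]_(x in cube c l) (`|f x| `^ p * v x)%:E) `^ p^-1.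

Lemma ereal_sup_lty_bound (S : set (\bar R)) : ereal_sup S < +oo ->
  exists2 K : R, (0 < K)%R & forall s, S s -> s <= K%:E.
Proof.
move=> Soo; exists (fine (maxe (ereal_sup S) 1)).
  apply: fine_gt0; rewrite lt_max lte01 orbT /= gt_max Soo ltry//.
move=> s Ss; rewrite fineK; last first.
  by rewrite gt0_fin_numE ?lt_max ?lte01 ?orbT// gt_max Soo ltry.
by rewrite le_max; apply/orP; left; exact: ereal_sup_ubound.
Qed.

(** Moves the normalization of the averages in the Muckenhoupt condition into the
power of the measure of the cube. *)
Lemma normalized_average_power (g s q : R) (U : \bar R) :
  (0 < g)%R -> 0 <= U ->
  g%:E `^ (s + q^-1) * (g%:E^-1 * U) `^ q^-1 = g%:E `^ s * U `^ q^-1.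
Proof.
move=> g0 U0; rewrite poweRM// ?inve_ge0 ?lee_fin ?ltW//.
rewrite inver gt_eqF// !poweR_EFin muleA -EFinM; congr (_%:E * _).
by rewrite -(powR_inv1 (ltW g0)) -powRrM -powRD ?(gt_eqF g0) ?implybT// mulN1r addrK.
Qed.

(** Integrate X |f| <= K |f| v over Q, where X v^-1 <= K almost everywhere on Q.
The convention on 0 and +oo matters where v vanishes: if that happens on a set
of positive measure then X = 0. *)
Lemma muckenhoupt_1_testing q alpha b u v :
  measurable_fun setT u -> measurable_fun setT v ->
  (forall x, (0 <= u x)%R) -> (forall x, (0 <= v x)%R) ->
  muckenhoupt_1 q alpha b u v ->
  exists2 K : R, (0 < K)%R & testing K 1 q alpha b u v.
Proof.
move=> meas_u meas_v u0 v0 /ereal_sup_lty_bound[K K0 hK]; exists K => // c l f lc mf.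
set Q := cube c l; have mQ : measurable Q by exact: measurable_cube.
have [g g0 gE] := gaussian_cubeE lc.
set U := \int[gamma]_(x in Q) (u x)%:E.
have U0 : 0 <= U by apply: integral_ge0 => x _; rewrite lee_fin.
have /ess_supP : ess_sup (mrestr gamma (measurable_cube c l)) (fun x =>
    gamma Q `^ (alpha / d%:R + q^-1 - 1) *
    average Q (fun y => (u y)%:E) `^ q^-1 * (v x)%:E^-1) <= K%:E.
  by apply: hK; exists c, l.
rewrite /average -/U gE.
have -> : (alpha / d%:R + q^-1 - 1 = (alpha / d%:R - 1) + q^-1)%R by ring.
rewrite (@normalized_average_power g _ q)//.
set X := _ * U `^ _ => -[N [mN N0 hN]].
have X0 : 0 <= X by rewrite mule_ge0 ?poweR_ge0.
have mf1 : measurable_fun Q (fun x => `|f x|%:E).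
  by apply: measurable_funTS; apply/measurable_EFinP; exact: measurableT_comp.
rewrite -ge0_integralZl// invr1 poweRe1; last first.
  by apply: integral_ge0 => x _; rewrite lee_fin mulr_ge0// powR_ge0.
have mfv : measurable_fun Q (fun x => (`|f x| `^ 1 * v x)%:E).
  apply: measurable_funTS; apply/measurable_EFinP; apply: measurable_funM => //.
  apply: (measurableT_comp (measurable_powR _)); exact: measurableT_comp.
have fv0 x : Q x -> 0 <= (`|f x| `^ 1 * v x)%:E.
  by move=> _; rewrite lee_fin mulr_ge0// powR_ge0.
rewrite -ge0_integralZl//; last by rewrite lee_fin ltW.
apply: ae_ge0_le_integral => //.
- by move=> x _; rewrite mule_ge0.
- exact: measurable_funeM.
- by move=> x Qx; rewrite mule_ge0 ?fv0// lee_fin ltW.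
- exact: measurable_funeM.
exists (N `&` Q); split; [exact: measurableI|exact: N0|].
move=> x /= /not_implyP[Qx h]; split => //; apply: hN => /= hx; apply: h.
have {hx} : X * (v x)%:E^-1 <= K%:E by exact: hx.
rewrite powRr1//; move: (v0 x); rewrite inver le_eqVlt eq_sym => /predU1P[->|vx].
  rewrite eqxx => h; rewrite mulr0 mule0.
  suff -> : X = 0 by rewrite mul0e.
  apply/eqP; apply: contraT => Xn0; move: h.
  by rewrite gt0_muley ?lt0e ?Xn0.
rewrite gt_eqF//; move: X0; case: X => [x0| |]//; last first.
  by move=> _; rewrite gt0_mulye ?lte_fin ?invr_gt0.
rewrite -!EFinM !lee_fin ler_pdivrMr// => x00 h.
by rewrite mulrC mulrCA ler_wpM2l// mulrC.
Qed.

(** If the integral S of v^(1-p') over Q is infinite, then the finiteness of the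
Muckenhoupt constant forces X = 0; otherwise Hölder's inequality applies. *)
Lemma muckenhoupt_gt1_testing p q alpha b u v : (1 < p)%R -> (0 < q)%R ->
  measurable_fun setT u -> measurable_fun setT v ->
  (forall x, (0 <= u x)%R) -> (forall x, (0 <= v x)%R) ->
  muckenhoupt_gt1 p q alpha b u v ->
  exists2 K : R, (0 < K)%R & testing K p q alpha b u v.
Proof.
move=> p1 q0 meas_u meas_v u0 v0 /ereal_sup_lty_bound[K K0 hK]; exists K => // c l f lc mf.
set p' := (p / (p - 1))%R in hK.
have p0 : (0 < p)%R by lra.
have p10 : (0 < p - 1)%R by lra.
have p'0 : (0 < p')%R by rewrite divr_gt0.
have pp' : (p'^-1 = 1 - p^-1)%R by rewrite /p'; field; lra.
set Q := cube c l; have mQ : measurable Q by exact: measurable_cube.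
have [g g0 gE] := gaussian_cubeE lc.
set U := \int[gamma]_(x in Q) (u x)%:E.
have U0 : 0 <= U by apply: integral_ge0 => x _; rewrite lee_fin.
pose S := \int[gamma]_(x in Q) ((v x)%:E^-1 `^ (p' - 1)).
have S0 : 0 <= S by apply: integral_ge0 => x _; rewrite poweR_ge0.
have : gamma Q `^ (alpha / d%:R + q^-1 - p^-1) *
    average Q (fun y => (u y)%:E) `^ q^-1 *
    average Q (fun x => (v x)%:E^-1 `^ (p' - 1)) `^ p'^-1 <= K%:E.
  by apply: hK; exists c, l.
rewrite /average -/U -/S gE.
have -> : (alpha / d%:R + q^-1 - p^-1 = (alpha / d%:R - 1 + p'^-1) + q^-1)%R.
  by rewrite pp'; ring.
rewrite (@normalized_average_power g _ q)//.
rewrite muleAC (@normalized_average_power g _ p')//.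
rewrite muleAC.
set X := _ * U `^ _ => hX.
have X0 : 0 <= X by rewrite mule_ge0 ?poweR_ge0.
have F0 : 0 <= (\int[gamma]_(x in Q) (`|f x| `^ p * v x)%:E) `^ p^-1.
  exact: poweR_ge0.
have [Soo|] := ltP S +oo; last first.
  rewrite leye_eq => /eqP Sy; move: hX; rewrite Sy poweRyr ?invr_eq0 ?gt_eqF// => hX.
  suff -> : X = 0 by rewrite mul0e mule_ge0// lee_fin ltW.
  apply/eqP; apply: contraT => Xn0; move: hX.
  by rewrite gt0_muley ?lt0e ?Xn0.
have := weighted_hoelder p1 mQ mf meas_v v0 Soo; rewrite -/p' -/S => H.
apply: (le_trans (lee_wpmul2l X0 H)).
by rewrite muleCA muleC lee_wpmul2r.
Qed.

Lemma muckenhoupt_testing p q alpha b u v : (1 <= p)%R -> (0 < q)%R ->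
  measurable_fun setT u -> measurable_fun setT v ->
  (forall x, (0 <= u x)%R) -> (forall x, (0 <= v x)%R) ->
  muckenhoupt p q alpha b u v ->
  exists2 K : R, (0 < K)%R & testing K p q alpha b u v.
Proof.
move=> p1 q0 meas_u meas_v u0 v0; rewrite /muckenhoupt; case: ifPn => [/eqP ->|pn1].
  exact: muckenhoupt_1_testing.
by apply: muckenhoupt_gt1_testing => //; rewrite lt_def pn1.
Qed.

(** [testing] for the product of f and the indicator of G, solved for the integral
of u. *)
Lemma testing_weak K p q alpha b u v c l (G : set (d.-tuple R)) f (t : R) :
  (0 < K)%R -> (0 < p)%R -> (0 < q)%R -> (0 < t)%R ->
  (forall x, (0 <= u x)%R) -> (forall x, (0 <= v x)%R) ->
  testing K p q alpha b u v -> local_cube b c l ->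
  measurable G -> G `<=` cube c l -> measurable_fun setT f ->
  t%:E * gamma (cube c l) `^ (1 - alpha / d%:R) <= \int[gamma]_(x in G) `|f x|%:E ->
  \int[gamma]_(x in cube c l) (u x)%:E <=
    ((K / t) `^ q)%:E *
    (\int[gamma]_(x in G) (`|f x| `^ p * v x)%:E) `^ (q / p).
Proof.
move=> K0 p0 q0 t0 u0 v0 tst lc mG GQ mf.
have mI : measurable_fun setT (\1_G : _ -> R) by exact/measurable_indicP.
have mf' : measurable_fun setT (fun x => f x * \1_G x)%R by exact: measurable_funM.
have := tst c l _ lc mf'.
set Q := cube c l; have mQ : measurable Q by exact: measurable_cube.
have [g g0 gE] := gaussian_cubeE lc.
have -> : \int[gamma]_(x in Q) `|f x * \1_G x|%:E = \int[gamma]_(x in G) `|f x|%:E.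
  rewrite integral_mkcond [RHS]integral_mkcond; apply: eq_integral => x _.
  rewrite !patchE indicE; case: (boolP (x \in G)) => [xG|_].
    by rewrite (mem_set (GQ _ (set_mem xG))) mulr1.
  by rewrite mulr0 normr0 if_same.
have -> : \int[gamma]_(x in Q) (`|f x * \1_G x| `^ p * v x)%:E =
    \int[gamma]_(x in G) (`|f x| `^ p * v x)%:E.
  rewrite integral_mkcond [RHS]integral_mkcond; apply: eq_integral => x _.
  rewrite !patchE indicE; case: (boolP (x \in G)) => [xG|_].
    by rewrite (mem_set (GQ _ (set_mem xG))) mulr1.
  by rewrite mulr0 normr0 powR0 ?gt_eqF// mul0r if_same.
set U := \int[gamma]_(x in Q) (u x)%:E; set I := \int[gamma]_(x in G) `|f x|%:E.
set F := \int[gamma]_(x in G) _.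
have U0 : 0 <= U by apply: integral_ge0 => x _; rewrite lee_fin.
have F0 : 0 <= F by apply: integral_ge0 => x _; rewrite lee_fin mulr_ge0// powR_ge0.
rewrite gE !poweR_EFin => h1 h2.
have h3 : t%:E * U `^ q^-1 <= K%:E * F `^ p^-1.
  apply: le_trans h1.
  apply: le_trans (lee_wpmul2l _ h2); last by rewrite mule_ge0 ?poweR_ge0 ?lee_fin ?powR_ge0.
  rewrite -EFinM muleAC -EFinM (_ : (_ * (_ * _))%R = t)//.
  rewrite mulrCA -powRD ?(gt_eqF g0) ?implybT//.
  by rewrite -opprB addNr powRr0 mulr1.
have h4 : U `^ q^-1 <= (K / t)%:E * F `^ p^-1.
  by rewrite mulrC EFinM -muleA lee_pdivlMl.
have := @gt0_ler_poweR R q (ltW q0) (U `^ q^-1) ((K / t)%:E * F `^ p^-1).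
rewrite !in_itv/= !leey !andbT => /(_ (poweR_ge0 _ _)).
have Kt : (0 < K / t)%R by rewrite divr_gt0.
have : 0 <= (K / t)%:E * F `^ p^-1 by rewrite mule_ge0 ?poweR_ge0// lee_fin ltW.
move=> + H => /H /(_ h4).
rewrite -poweRrM mulVf ?gt_eqF// poweRe1// poweRM ?poweR_ge0//; last by rewrite lee_fin ltW.
by rewrite poweR_EFin -poweRrM [(p^-1 * q)%R]mulrC.
Qed.

End muckenhoupt_testing.

(** * Integrals over coverings and packings *)

(** At x = 0 this is not an instance of the additivity of exponents. *)
Lemma powR_succ (R : realType) (x r : R) : 0 <= x -> 1 <= r ->
  x `^ r = x `^ (r - 1) * x.
Proof.
move=> x0 r1; have [->|xn0] := eqVneq x 0.
  by rewrite mulr0 powR0// gt_eqF// (lt_le_trans ltr01).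
have -> : x `^ r = x `^ (r - 1 + 1) by rewrite subrK.
by rewrite powRD ?xn0 ?implybT// powRr1.
Qed.

Lemma measurable_bigcup_countType {dT} {T : measurableType dT} (I : countType)
    (A : set I) (P : I -> set T) :
  (forall i, A i -> measurable (P i)) -> measurable (\bigcup_(i in A) P i).
Proof.
move=> mP; rewrite bigcup_mkcond; apply: countable_bigcupT_measurable => // i.
by case: ifPn => // /set_mem; exact: mP.
Qed.

Section covering_integrals.
Context {dT} {T : measurableType dT} {R : realType}.
Variable mu : {measure set T -> \bar R}.
Local Open Scope ereal_scope.

(** E may fail to be measurable: the integral of a nonnegative function is a
supremum over the simple functions below it, hence monotone in the function
and in the set whether or not these are measurable. *)
Lemma le_integral_superset (E W : set T) (f : T -> \bar R) :
  E `<=` W -> \int[mu]_(x in E) f x <= \int[mu]_(x in W) f^\+ x.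
Proof.
move=> EW; rewrite integralE.
apply: (@le_trans _ _ (\int[mu]_(x in E) f^\+ x)).
  by rewrite -[leRHS]adde0 leeD// oppe_le0 integral_ge0.
rewrite !ge0_integralE//; apply: le_ereal_sup => _ [h /= hE <-]; exists h => //= x.
apply: (le_trans (hE x)); rewrite !patchE.
case: (boolP (x \in E)) => [xE|_]; first by rewrite (mem_set (EW _ (set_mem xE))).
by case: (x \in W) => //; exact: funepos_ge0.
Qed.

Variable u : T -> R.
Hypotheses (u0 : forall x, (0 <= u x)%R) (meas_u : measurable_fun setT u).
Local Notation U A := (\int[mu]_(x in A) (u x)%:E).

Let mEu A : measurable_fun A (fun x => (u x)%:E).
Proof. by apply: measurable_funTS; exact/measurable_EFinP. Qed.

Let U_ge0 A : 0 <= U A.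
Proof. by apply: integral_ge0 => x _; rewrite lee_fin. Qed.

Lemma integral_bigcup_le (P : (set T)^nat) : (forall n, measurable (P n)) ->
  U (\bigcup_n P n) <= \sum_(n <oo) U (P n).
Proof.
move=> mP; rewrite seqDU_bigcup_eq ge0_integral_bigcup//; last 2 first.
- exact: seqDU_measurable.
- by move=> x _; rewrite lee_fin.
apply: lee_nneseries => // n _; apply: ge0_subset_integral => //.
- exact: seqDU_measurable.
- by move=> x _; rewrite lee_fin.
- exact: subset_seqDU.
Qed.

Lemma integral_finite_cover_le (C : finType) (W : C -> set T) (E : set T) (B : \bar R) :
  measurable E -> (forall c, measurable (W c)) -> E `<=` \bigcup_c W c ->
  (forall c, U (W c) <= B) -> U E <= #|C|%:R%:E * B.
Proof.
move=> mE mW EW UB.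
have finU (s : seq C) : U (\big[setU/set0]_(c <- s) W c) <= (size s)%:R%:E * B.
  elim: s => [|c s IH]; first by rewrite big_nil integral_set0 mul0e.
  have mS : measurable (\big[setU/set0]_(i <- s) W i) by exact: bigsetU_measurable.
  rewrite big_cons /= -natr1 EFinD ge0_muleDl ?lee_fin// mul1e addeC.
  have -> : W c `|` \big[setU/set0]_(i <- s) W i =
      W c `|` (\big[setU/set0]_(i <- s) W i `\` W c).
    by apply/seteqP; split=> x [Wx|Sx]; [left|case: (pselect (W c x)); [left|right]
      |left|right; case: Sx].
  rewrite ge0_integral_setU//; last 3 first.
  - exact: measurableD.
  - by move=> x _; rewrite lee_fin.
  - by apply/disj_setPS => x [? []].
  apply: leeD => //; apply: le_trans IH; apply: ge0_subset_integral => //.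
  - exact: measurableD.
  - by move=> x _; rewrite lee_fin.
apply: (@le_trans _ _ (U (\big[setU/set0]_(c <- enum C) W c))).
  apply: ge0_subset_integral => //.
  - exact: bigsetU_measurable.
  - by move=> x _; rewrite lee_fin.
  - move=> x /EW[c _ Wx]; rewrite -bigcup_seq; exists c => //=.
    by rewrite mem_enum.
by rewrite cardE; exact: finU.
Qed.

(** Since r >= 1, the power r of the integral of F over Q_i is at most that
integral times the power r - 1 of the integral over the whole space; the
integrals over the disjoint sets Q_i then add up. *)
Lemma integral_packing (I : countType) (A : set I) (P Q : I -> set T)
    (F : T -> R) (K r : R) :
  (forall i, A i -> measurable (P i)) -> (forall i, A i -> measurable (Q i)) ->
  trivIset A Q -> (forall x, (0 <= F x)%R) -> measurable_fun setT F ->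
  (1 <= r)%R -> (0 <= K)%R -> \int[mu]_x (F x)%:E < +oo ->
  (forall i, A i -> U (P i) <= K%:E * (\int[mu]_(x in Q i) (F x)%:E) `^ r) ->
  U (\bigcup_(i in A) P i) <= K%:E * (\int[mu]_x (F x)%:E) `^ r.
Proof.
move=> mP mQ tQ F0 mF r1 K0 Foo H.
have mEF B : measurable_fun B (fun x => (F x)%:E).
  by apply: measurable_funTS; exact/measurable_EFinP.
have EF0 B : 0 <= \int[mu]_(x in B) (F x)%:E.
  by apply: integral_ge0 => x _; rewrite lee_fin.
pose seqI (V : I -> set T) n : set T :=
  if pickle_inv n is Some i then [set x | A i /\ V i x] else set0.
have seqI_cup V : \bigcup_(i in A) V i = \bigcup_n seqI V n.
  apply/seteqP; split=> x [k].
    by move=> Ak Vx; exists (pickle k) => //; rewrite /seqI pickleK_inv.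
  by rewrite /seqI; case: pickle_inv => // i _ [Ai Vx]; exists i.
have seqI_meas V : (forall i, A i -> measurable (V i)) -> forall n, measurable (seqI V n).
  move=> mV n; rewrite /seqI; case: pickle_inv => // i.
  have [Ai|nAi] := pselect (A i).
    rewrite (_ : [set x | _] = V i); first exact: mV.
    by apply/seteqP; split => [x []|x].
  by rewrite (_ : [set x | _] = set0)//; apply/seteqP; split => [x []|x].
have seqI_triv : trivIset setT (seqI Q).
  move=> n m _ _ [x []]; rewrite /seqI.
  case En : (pickle_inv n) => [i|//]; case Em : (pickle_inv m) => [j|//].
  move=> [Ai Qi] [Aj Qj].
  have ij : i = j by apply: tQ => //; exists x.
  have := @pickle_invK I n; rewrite En /= => <-.
  by have := @pickle_invK I m; rewrite Em /= => <-; rewrite ij.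
set X := \int[mu]_x (F x)%:E.
have Xfin : X \is a fin_num by rewrite ge0_fin_numE; [exact: Foo|exact: EF0].
(* The power r is linearized once and for all by the constant fine X `^ (r - 1). *)
have step n : U (seqI P n) <= (K * fine X `^ (r - 1))%:E * \int[mu]_(x in seqI Q n) (F x)%:E.
  have C0 : 0 <= (K * fine X `^ (r - 1))%:E by rewrite lee_fin mulr_ge0 ?powR_ge0.
  rewrite /seqI; case: pickle_inv => [i|]; last by rewrite integral_set0 mule_ge0.
  have [Ai|nAi] := pselect (A i); last first.
    rewrite (_ : [set x | _] = set0) ?integral_set0 ?mule_ge0//.
    by apply/seteqP; split => [x []|x].
  have Vi V : [set x | A i /\ V i x] = V i by apply/seteqP; split => [x []|x].
  rewrite !Vi; apply: (le_trans (H i Ai)).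
  rewrite EFinM -muleA lee_wpmul2l//.
  set Y := \int[mu]_(x in Q i) _.
  have YX : Y <= X.
    apply: ge0_subset_integral => //; first exact: mQ.
    by move=> x _; rewrite lee_fin.
  have Yfin : Y \is a fin_num by rewrite ge0_fin_numE ?EF0// (le_lt_trans YX).
  rewrite -(fineK Yfin) -EFinM poweR_EFin lee_fin.
  have y0 : (0 <= fine Y)%R by rewrite fine_ge0 ?EF0//.
  have yx : (fine Y <= fine X)%R by rewrite fine_le.
  rewrite (powR_succ y0 r1).
  by rewrite ler_wpM2r// ge0_ler_powR ?nnegrE ?subr_ge0// fine_ge0 ?EF0.
rewrite seqI_cup; apply: (le_trans (integral_bigcup_le (seqI_meas _ mP))).
apply: le_trans; first by apply: lee_nneseries => [n _ _|n _]; [exact: U_ge0|exact: step].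
rewrite nneseriesZl//.
rewrite -ge0_integral_bigcup//; last 2 first.
- exact: seqI_meas.
- by move=> x _; rewrite lee_fin.
have mB : measurable (\bigcup_k seqI Q k) by apply: bigcupT_measurable; exact: seqI_meas.
have YX : \int[mu]_(x in \bigcup_k seqI Q k) (F x)%:E <= X.
  by apply: ge0_subset_integral => // x _; rewrite lee_fin.
apply: (le_trans (lee_wpmul2l _ YX)); first by rewrite lee_fin mulr_ge0 ?powR_ge0.
rewrite EFinM -muleA lee_wpmul2l// -(fineK Xfin) -EFinM poweR_EFin lee_fin.
by rewrite [fine _%:E]/= -powR_succ// fine_ge0 ?EF0.
Qed.

End covering_integrals.

(** * Grids of dyadic cells *)

Section grid.
Context {R : realType} {d : nat}.
Implicit Types (x y z c : d.-tuple R) (s l r : R) (n : {ffun 'I_d -> int}).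

(** The half-open cube with lower corner s n and side s, described by floors so
that the cells of one side form a partition by construction. *)
Definition cell s n : set (d.-tuple R) :=
  [set x | forall i, Num.floor (tnth x i / s) = n i].

Definition cell_index s x : {ffun 'I_d -> int} :=
  [ffun i => Num.floor (tnth x i / s)].

Definition cell_center s n : d.-tuple R :=
  [tuple s * ((n i)%:~R + 2^-1) | i < d].

Lemma mem_cell_index s x : cell s (cell_index s x) x.
Proof. by move=> i; rewrite ffunE. Qed.

Lemma cell_inj s n n' x : cell s n x -> cell s n' x -> n = n'.
Proof. by move=> xn xn'; apply/ffunP => i; rewrite -xn -xn'. Qed.

Lemma cellP s n x : 0 < s -> cell s n x <->
  forall i, s * (n i)%:~R <= tnth x i < s * (n i)%:~R + s.
Proof.
move=> s0; split => h i.
  have /eqP := h i; rewrite floor_eq intrD => /andP[].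
  rewrite ler_pdivlMr// ltr_pdivrMr//; lra.
apply/eqP; rewrite floor_eq intrD ler_pdivlMr// ltr_pdivrMr//.
have := h i; lra.
Qed.

Lemma measurable_cell s n : 0 < s -> measurable (cell s n).
Proof.
move=> s0; rewrite (_ : cell s n = \bigcap_(i in [set: 'I_d])
    ((@tnth d R)^~ i @^-1` `[s * (n i)%:~R, s * (n i)%:~R + s[)); last first.
  rewrite predeqE => x; split => [/(cellP _ _ s0) h i _|h].
    by rewrite /= in_itv/=; exact: h.
  by apply/(cellP _ _ s0) => i; have := h i Logic.I; rewrite /= in_itv.
apply: fin_bigcap_measurable => // i _.
by rewrite -[X in measurable X]setTI; exact: measurable_tnth.
Qed.

Lemma mem_cell_center s n : 0 < s -> cell s n (cell_center s n).
Proof. by move=> s0; apply/(cellP _ _ s0) => i; rewrite tnth_mktuple; lra. Qed.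

Lemma cell_dist s n x y i : 0 < s -> cell s n x -> cell s n y ->
  `|tnth x i - tnth y i| <= s.
Proof.
move=> s0 /(cellP _ _ s0)/(_ i) hx /(cellP _ _ s0)/(_ i) hy.
by rewrite ler_norml; lra.
Qed.

Lemma cell_sub_cube s n : 0 < s -> cell s n `<=` cube (cell_center s n) s.
Proof.
move=> s0 x /(cellP _ _ s0) h i; have := h i.
by rewrite tnth_mktuple ler_norml; lra.
Qed.

Lemma cell_index_dist s n n' x y r i : 0 < s -> cell s n x -> cell s n' y ->
  `|tnth x i - tnth y i| <= r * s -> `|((n i)%:~R - (n' i)%:~R : R)| < r + 1.
Proof.
move=> s0 /(cellP _ _ s0)/(_ i) hx /(cellP _ _ s0)/(_ i) hy.
rewrite ler_norml ltr_norml => /andP[h1 h2].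
by apply/andP; split; rewrite -(ltr_pM2l s0); lra.
Qed.

(** The index of a point at the coarse side is determined by its index at the fine
side, as floor(N t) determines floor(t). *)
Lemma cell_nested (N : nat) s n n' : 0 < s -> (0 < N)%N ->
  cell s n `&` cell (s * N%:R) n' !=set0 -> cell s n `<=` cell (s * N%:R) n'.
Proof.
move=> s0 N0 [z [zn zn']] x xn i; rewrite -zn'.
have N0' : 0 < N%:R :> R by rewrite ltr0n.
have E t : t / s = N%:R * (t / (s * N%:R)).
  by field; rewrite !gt_eqF.
have : Num.floor (tnth x i / s) = Num.floor (tnth z i / s) by rewrite xn zn.
rewrite !E; set w := tnth x i / _; set w' := tnth z i / _.
have mono (a b : R) : Num.floor (N%:R * a) = Num.floor (N%:R * b) ->
    Num.floor a <= Num.floor b.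
  move=> ab; rewrite floor_ge_int -(ler_pM2l N0').
  rewrite -[N%:R]/(N%:Z%:~R) -intrM -floor_ge_int -ab floor_ge_int intrM.
  by rewrite ler_pM2l// floor_le.
by move=> h; apply/eqP; rewrite eq_le !mono.
Qed.

Definition side s (k : nat) : R := s / 2 ^+ k.

Lemma side_gt0 s k : 0 < s -> 0 < side s k.
Proof. by move=> s0; rewrite divr_gt0// exprn_gt0. Qed.

Lemma sideM s k j : side s k = side s (k + j) * (2 ^ j)%:R.
Proof.
rewrite /side natrX exprD; field.
by rewrite !expf_neq0// pnatr_eq0.
Qed.

Lemma dyadic_nested s k k' n n' : 0 < s -> (k' <= k)%N ->
  cell (side s k) n `&` cell (side s k') n' !=set0 ->
  cell (side s k) n `<=` cell (side s k') n'.
Proof.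
move=> s0 /subnKC <-; rewrite (sideM s k' (k - k')).
by apply: cell_nested; [exact: side_gt0|rewrite expn_gt0].
Qed.

Lemma exists_side s t : 0 < t -> t <= s -> exists k, t <= side s k < 2 * t.
Proof.
move=> t0 ts.
have ex : exists k, side s k < 2 * t.
  exists (Num.bound (s / (2 * t))); rewrite /side ltr_pdivrMr ?exprn_gt0//.
  rewrite -ltr_pdivrMl; last lra.
  rewrite mulrC; apply: (lt_trans (archi_boundP _)).
    by rewrite divr_ge0//; lra.
  by rewrite -natrX ltr_nat ltn_expl.
case: (ex_minnP ex) => -[|k] hk kmin.
  by exists 0%N; rewrite hk /side expr0 divr1 ts.
exists k.+1; rewrite hk andbT.
have : ~~ (side s k < 2 * t) by apply/negP => /kmin; rewrite ltnn.
rewrite -leNgt (sideM s k 1) addn1 expn1; lra.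
Qed.

(** The strict inequality between the generations matters: the side at least
doubles, so the center of the small cell, being in the big cell, is close
enough to the big center for the triples to be nested. *)
Lemma subset_triple_cube s k k' n n' : 0 < s -> (k' < k)%N ->
  cell (side s k) n `<=` cell (side s k') n' ->
  cube (cell_center (side s k) n) (3 * side s k) `<=`
  cube (cell_center (side s k') n') (3 * side s k').
Proof.
move=> s0 kk sub; apply: subset_cube => i.
have := cell_sub_cube (side_gt0 k' s0) (sub _ (mem_cell_center n (side_gt0 k s0))) i.
have : 2 * side s k <= side s k'.
  rewrite -(subnKC kk) addSnnS (sideM s k' (k - k'.+1).+1) mulrC.
  by rewrite ler_pM2l ?side_gt0// ler_nat -{1}(expn1 2) leq_exp2l.
have := side_gt0 k s0; lra.
Qed.

(** The subfamily of the cells that are contained in no cell of G of an earlier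
generation.  Every cell of G is in one of them, because generations are natural
numbers; two of them that meet are nested, hence equal. *)
Lemma maximal_dyadic s (G : set (nat * {ffun 'I_d -> int})) : 0 < s ->
  exists A, [/\ A `<=` G, trivIset A (fun i => cell (side s i.1) i.2) &
    \bigcup_(i in G) cube (cell_center (side s i.1) i.2) (3 * side s i.1) `<=`
    \bigcup_(i in A) cube (cell_center (side s i.1) i.2) (3 * side s i.1)].
Proof.
move=> s0; pose D (i : nat * {ffun 'I_d -> int}) := cell (side s i.1) i.2.
exists [set i | G i /\ forall j, G j -> (j.1 < i.1)%N -> ~ (D i `<=` D j)].
split; first by move=> i [].
  have wlogD i j : G i -> (forall j, G j -> (j.1 < i.1)%N -> ~ (D i `<=` D j)) ->
      G j -> D i `&` D j !=set0 -> (j.1 <= i.1)%N -> i = j.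
    move=> Gi Mi Gj Dij; rewrite leq_eqVlt => /predU1P[|ji]; last first.
      by case: (Mi _ Gj ji); apply: dyadic_nested => //; exact: ltnW.
    case: i j {Gi Mi Gj} Dij => [k n] [k' n'] /= [z [/= zn zn']] kk'.
    rewrite /D/= in zn zn'; rewrite kk' in zn' *.
    by rewrite (cell_inj zn zn').
  move=> i j [Gi Mi] [Gj Mj] Dij.
  case: (leqP j.1 i.1) => ij; first exact: wlogD.
  by apply/esym/wlogD => //; [rewrite setIC|exact: ltnW].
move=> x [i Gi xi].
have [m] := ubnP i.1; elim: m i Gi xi => // m IH i Gi xi im.
have [Mi|] := pselect (forall j, G j -> (j.1 < i.1)%N -> ~ (D i `<=` D j)).
  by exists i.
move=> /existsNP[j] /not_implyP[Gj] /not_implyP[ji] /contrapT Dij.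
apply: (IH j) => //; last exact: leq_trans ji _.
exact: subset_triple_cube Dij _ xi.
Qed.

(** A cube of side at most s meets at most two cells of side s in each direction;
the choice between the two is encoded by the booleans. *)
Lemma cells_cover s c l : 0 < s -> l <= s ->
  exists D : {ffun 'I_d -> bool} -> {ffun 'I_d -> int},
    cube c l `<=` \bigcup_e cell s (D e) /\
    forall e, cube c l `<=` cube (cell_center s (D e)) (3 * s).
Proof.
move=> s0 ls; pose n0 i := Num.floor ((tnth c i - l / 2) / s).
have n0P i : s * (n0 i)%:~R <= tnth c i - l / 2 < s * (n0 i)%:~R + s.
  have := floor_itv ((tnth c i - l / 2) / s); rewrite -/(n0 i) intrD.
  rewrite ler_pdivlMr// ltr_pdivrMr//; lra.
exists (fun e : {ffun 'I_d -> bool} => [ffun i => n0 i + (nat_of_bool (e i))%:Z]); split.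
  move=> x xQ; exists [ffun i => s * (n0 i)%:~R + s <= tnth x i] => //.
  apply/(cellP _ _ s0) => i; have := n0P i; have := xQ i.
  rewrite !ffunE intrD ler_norml.
  by case: (leP (s * (n0 i)%:~R + s) (tnth x i)) => h /=; lra.
move=> e; apply: subset_cube => i; have := n0P i.
rewrite tnth_mktuple ffunE intrD ler_norml.
by case: (e i) => /=; lra.
Qed.

Lemma eq_modn_small (m k k' : nat) : (k %% m = k' %% m)%N ->
  (k < k' + m)%N -> (k' < k + m)%N -> k = k'.
Proof.
have W j j' : (j <= j')%N -> (j %% m = j' %% m)%N -> (j' < j + m)%N -> j = j'.
  move=> jj' /eqP; rewrite eq_sym eqn_mod_dvd// => dv lt.
  apply/eqP; rewrite eqn_leq jj' -subn_eq0 /=.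
  by apply/negPn/negP => n0; have := dvdn_leq _ dv; rewrite lt0n n0 => /(_ isT); lia.
move=> e h h'; case: (leqP k k') => kk; first exact: W.
by apply/esym; apply: W => //; exact: ltnW.
Qed.

Lemma eq_modz_small (m : nat) (k k' : int) : (0 < m)%N ->
  (k %% m)%Z = (k' %% m)%Z -> (`|k - k'| < m%:Z)%R -> k = k'.
Proof.
move=> m0 e lt; apply/eqP; rewrite -subr_eq0 -absz_eq0.
apply/negPn/negP => n0; have /dvdn_leq : (m %| `|k - k'|)%N.
  by rewrite -[m in (m %| _)%N]absz_nat -dvdzE -eqz_mod_dvd; apply/eqP.
by rewrite lt0n n0 => /(_ isT); lia.
Qed.

(** Generation and index modulo fixed numbers: distinct cells of the same colour
differ either much in generation or much in position. *)
Definition colour (K1 N1 : nat) (i : nat * {ffun 'I_d -> int}) :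
    'I_K1.+1 * {ffun 'I_d -> 'I_N1.+1} :=
  (inord (i.1 %% K1.+1), [ffun j => inord `|(i.2 j %% N1.+1%:Z)%Z|%N]).

Lemma colour_inj K1 N1 i j : colour K1 N1 i = colour K1 N1 j ->
  (i.1 <= j.1 + K1)%N -> (j.1 <= i.1 + K1)%N ->
  (i.1 = j.1 -> forall h, `|i.2 h - j.2 h|%R <= N1%:Z)%R -> i = j.
Proof.
case: i j => [k n] [k' n'] /= [e1 e2] h1 h2 h3.
have kk' : k = k'.
  apply: (@eq_modn_small K1.+1); rewrite ?addnS ?ltnS//.
  by have := congr1 val e1; rewrite /= !inordK ?ltn_mod.
congr (_, _) => //.
apply/ffunP => h; apply: (@eq_modz_small N1.+1) => //; last first.
  by rewrite (le_lt_trans (h3 kk' h))// ltz_nat.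
have := congr1 (fun g : {ffun 'I_d -> 'I_N1.+1} => val (g h)) e2.
have m0 : (N1.+1%:Z != 0)%R by [].
have lt (z : int) : (`|(z %% N1.+1%:Z)%Z| < N1.+1)%N.
  by have := modz_ge0 z m0; have := @ltz_pmod z N1.+1%:Z isT; lia.
rewrite /= !ffunE !inordK//.
by have := modz_ge0 (n h) m0; have := modz_ge0 (n' h) m0; lia.
Qed.

(** A crude logarithm: 2^j <= M implies j < M. *)
Lemma side_ratio (s : R) k k' (M : nat) : (0 < s)%R ->
  (side s k <= M%:R * side s k')%R -> (k' <= k + M)%N.
Proof.
move=> s0' h; rewrite leqNgt; apply/negP => kk.
have kk' : (k <= k')%N by rewrite (leq_trans (leq_addr M k))// ltnW.
move: h; rewrite (sideM s k (k' - k)) subnKC// mulrC ler_pM2r ?side_gt0// ler_nat.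
move=> h; have := leq_trans (ltn_expl (k' - k) (ltnSn 1)) h; lia.
Qed.

End grid.

(** * Covering the cubes with a large average *)

Section weak_type.
Context {R : realType} {d : nat}.
Local Notation gamma := (gaussian R d).
Implicit Types (f : d.-tuple R -> R) (c x : d.-tuple R) (l lam : R).
Variables (K p q alpha b : R) (u v : d.-tuple R -> R).
Hypotheses (K0 : 0 < K) (p1 : 1 <= p) (pq : p <= q).
Hypotheses (alpha0 : 0 <= alpha) (alphad : alpha < d%:R) (b0 : 0 < b).
Hypotheses (meas_u : measurable_fun setT u) (meas_v : measurable_fun setT v).
Hypotheses (u0 : forall x, 0 <= u x) (v0 : forall x, 0 <= v x).
Hypothesis tst : testing K p q alpha b u v.

Local Open Scope ereal_scope.

Local Notation U A := (\int[gamma]_(x in A) (u x)%:E).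

Let p0 : (0 < p)%R. Proof. exact: lt_le_trans p1. Qed.
Let q0 : (0 < q)%R. Proof. exact: lt_le_trans pq. Qed.
Let qp1 : (1 <= q / p)%R. Proof. by rewrite ler_pdivlMr// mul1r. Qed.
Let s0 : (0 < 1 - alpha / d%:R)%R.
Proof.
have d0 : (0 < d%:R :> R)%R by exact: le_lt_trans alphad.
by rewrite subr_gt0 ltr_pdivrMr// mul1r.
Qed.

Let mFp f : measurable_fun setT f -> measurable_fun setT (fun x => `|f x| `^ p * v x)%R.
Proof.
move=> mf; apply: measurable_funM => //.
by apply: (measurableT_comp (measurable_powR _)); exact: measurableT_comp.
Qed.

Let Fp0 f x : (0 <= `|f x| `^ p * v x)%R.
Proof. by rewrite mulr_ge0// powR_ge0. Qed.

Lemma mem_cube_center c l : (0 <= l)%R -> cube c l c.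
Proof. by move=> l0 i; rewrite subrr normr0 divr_ge0. Qed.

Definition large_average f lam c l : Prop :=
  lam%:E * gamma (cube c l) `^ (1 - alpha / d%:R) <
  \int[gamma]_(x in cube c l) `|f x|%:E.

Definition dilate_cst k sg : R :=
  ((K * doubling_cst d b k `^ (1 - alpha / d%:R) / sg) `^ q)%R.

Lemma doubling_cst_gt0 k : (0 < k)%R -> (0 < doubling_cst d b k)%R.
Proof. by move=> k0; rewrite mulr_gt0 ?expR_gt0 ?exprn_gt0. Qed.

Lemma dilate_cst_gt0 k sg : (0 < k)%R -> (0 < sg)%R -> (0 < dilate_cst k sg)%R.
Proof.
move=> k0 sg0; apply: powR_gt0; apply: divr_gt0 => //; apply: mulr_gt0 => //.
by apply: powR_gt0; exact: doubling_cst_gt0.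
Qed.

(** The cube c l carries the large average, the cube c' l' around it is the one
over which u is integrated, and G is where |f| has its mass.  The factor sg is
the share of the average that G retains. *)
Lemma testing_dilate k sg lam c l c' l' (G : set (d.-tuple R)) f :
  (0 < k)%R -> (0 < sg)%R -> (0 < lam)%R ->
  local_cube b c' l' -> (0 < l)%R -> cube c l `<=` cube c' l' -> (l' <= k * l)%R ->
  measurable G -> G `<=` cube c' l' -> measurable_fun setT f ->
  (sg * lam)%:E * gamma (cube c l) `^ (1 - alpha / d%:R) <=
    \int[gamma]_(x in G) `|f x|%:E ->
  U (cube c' l') <= (dilate_cst k sg / lam `^ q)%:E *
    (\int[gamma]_(x in G) (`|f x| `^ p * v x)%:E) `^ (q / p).
Proof.
move=> k0 sg0 lam0 lc l0 QQ lk mG GQ mf H.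
set D := doubling_cst d b k; have D0 : (0 < D)%R by exact: doubling_cst_gt0.
have sgt0 := s0; set s := (1 - alpha / d%:R)%R in sgt0 H.
have Ds0 : (0 < D `^ s)%R by exact: powR_gt0.
pose t := (sg * lam / D `^ s)%R.
have t0 : (0 < t)%R by rewrite divr_gt0// mulr_gt0.
have := @testing_weak _ _ K p q alpha b u v c' l' G f t K0 p0 q0 t0 u0 v0 tst lc mG GQ mf.
have -> : ((K / t) `^ q = dilate_cst k sg / lam `^ q)%R.
  rewrite /dilate_cst -/D -/s.
  have -> : (K / t = K * D `^ s / sg * lam^-1)%R by rewrite /t; field; rewrite !gt_eqF.
  rewrite powRM ?invr_ge0 ?ltW//; last by rewrite divr_gt0// mulr_gt0.
  by rewrite -(powR_inv1 (ltW lam0)) -powRrM mulN1r powRN.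
apply; apply: le_trans H.
have g0 : 0 <= gamma (cube c l) by exact: measure_ge0.
have : gamma (cube c' l') `^ s <= (D%:E * gamma (cube c l)) `^ s.
  apply: gt0_ler_poweR; first exact: ltW.
  - by rewrite in_itv/= leey measure_ge0.
  - by rewrite in_itv/= leey mule_ge0// lee_fin ltW.
  - exact: gaussian_doubling QQ lk.
rewrite poweRM//; last by rewrite lee_fin ltW.
rewrite poweR_EFin => h; apply: (le_trans (lee_wpmul2l _ h)); first by rewrite lee_fin ltW.
by rewrite muleA -EFinM /t divfK// gt_eqF.
Qed.

(** The cells in which |f| has so much mass that [testing_dilate] applies to their
triple. *)
Definition good_cell (tau lam : R) f : set (nat * {ffun 'I_d -> int}) :=
  [set i | local_cube b (cell_center (side 1 i.1) i.2) (3 * side 1 i.1) /\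
    (tau * lam)%:E * gamma (cube (cell_center (side 1 i.1) i.2) (3 * side 1 i.1))
       `^ (1 - alpha / d%:R) <=
    \int[gamma]_(x in cell (side 1 i.1) i.2) `|f x|%:E].

(** Covering by the triples of the maximal good cells. *)
Lemma small_cubes : exists eps C : R, [/\ (0 < eps)%R, (0 < C)%R &
  forall f lam, measurable_fun setT f ->
    \int[gamma]_x (`|f x| `^ p * v x)%:E < +oo -> (0 < lam)%R ->
    exists W, [/\ measurable W,
      forall c l, local_cube eps c l -> large_average f lam c l -> cube c l `<=` W &
      U W <= (C / lam `^ q)%:E *
        (\int[gamma]_x (`|f x| `^ p * v x)%:E) `^ (q / p)]].
Proof.
pose B : R := (2 + 2 * d%:R * 3 ^+ 2)%R.
have B0 : (0 < B)%R by rewrite /B; have := ler0n R d; nra.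
(* A cube of side l gets cells of side less than 2 l, whose triples have side less
   than 6 l, and the critical scale at the centers of these is that of the cube
   up to the factor B.  The bound eps <= 1 is there because the coarsest cells
   have side 1. *)
pose eps : R := Num.min 1%R (b / (6 * B))%R.
have eps0 : (0 < eps)%R by rewrite lt_min ltr01 divr_gt0// mulr_gt0.
have eps1 : (eps <= 1)%R by rewrite ge_min lexx.
have epsb : (6 * B * eps <= b)%R.
  by rewrite mulrC -ler_pdivlMr ?mulr_gt0// ge_min lexx orbT.
pose D6 : R := doubling_cst d b 6.
have D60 : (0 < D6)%R by exact: doubling_cst_gt0.
pose N : R := (#|{: {ffun 'I_d -> bool}}|%:R)%R.
have N0 : (0 < N)%R by rewrite ltr0n; apply/card_gt0P; exists [ffun=> true]; rewrite inE.
have sgt0 := s0; set s := (1 - alpha / d%:R)%R in sgt0 *.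
have D6s0 : (0 < D6 `^ s)%R by exact: powR_gt0.
(* The factor N^-1 is lost in the choice of one of the N cells that cover a cube,
   the other one in passing from the cube to the triple of that cell. *)
pose tau : R := (N^-1 / D6 `^ s)%R.
have tau0 : (0 < tau)%R by rewrite divr_gt0// invr_gt0.
exists eps, (dilate_cst 1 tau); split => //; first exact: dilate_cst_gt0.
move=> f lam mf Foo lam0.
have [A [AG tA GA]] := @maximal_dyadic R d 1%R (good_cell tau lam f) ltr01.
have sd k : (0 < side 1 k :> R)%R by exact: side_gt0.
exists (\bigcup_(i in A) cube (cell_center (side 1 i.1) i.2) (3 * side 1 i.1)); split.
- by apply: measurable_bigcup_countType => i _; exact: measurable_cube.
- move=> c l lc la; have [l0 lb] := (local_cubeE _ _ _).1 lc.
  have le1 : (l <= eps)%R by exact: local_cube_side lc.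
  have [k /andP[lk kl]] := exists_side l0 (le_trans le1 eps1).
  have [D [DQ QD]] := @cells_cover R d (side 1 k) c l (sd k) lk.
  have lcD e : local_cube b (cell_center (side 1 k) (D e)) (3 * side 1 k).
    apply/local_cubeE; split; first by rewrite mulr_gt0.
    have near : (scale (cell_center (side 1 k) (D e)) <= B * scale c)%R.
      apply: scale_near => i; rewrite distrC.
      by apply: (le_trans (QD e c (mem_cube_center _ (ltW l0)) i)); lra.
    apply: (@le_trans _ _ (6 * l * (B * scale c))%R).
      apply: ler_pM => //; rewrite ?mulr_ge0 ?ltW ?scale_gt0//.
      by lra.
    apply: le_trans epsb.
    rewrite [leLHS](_ : _ = 6 * B * (l * scale c))%R; last by ring.
    by rewrite ler_wpM2l// mulr_ge0// ltW.
  (* Otherwise the N = 2^d cells that cover the cube would together carry at most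
     the integral that makes its average lam. *)
  have [e He] : exists e, (N^-1 * lam)%:E * gamma (cube c l) `^ s <
      \int[gamma]_(x in cell (side 1 k) (D e)) `|f x|%:E.
    apply: contrapT => /forallNP H; move: la; rewrite /large_average ltNge => /negP; apply.
    have := @integral_finite_cover_le _ _ _ gamma (fun x => `|f x|%R) _ _ _ _ _
      ((N^-1 * lam)%:E * gamma (cube c l) `^ s) (measurable_cube c l) _ DQ.
    rewrite -/N muleA -EFinM mulVKf ?gt_eqF//; apply => //.
    + by apply: measurableT_comp.
    + by move=> e; exact: measurable_cell.
    + by move=> e; have := H e; rewrite leNgt => /negP.
  apply: (subset_trans (QD e)) => x xD; apply: GA; exists (k, D e) => //; split => //=.
  apply: le_trans (ltW He).
  have : gamma (cube (cell_center (side 1 k) (D e)) (3 * side 1 k)) `^ s <=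
      (D6%:E * gamma (cube c l)) `^ s.
    apply: gt0_ler_poweR; first exact: ltW.
    - by rewrite in_itv/= leey measure_ge0.
    - by rewrite in_itv/= leey mule_ge0// lee_fin ltW.
    - by apply: (gaussian_doubling (lcD e) l0 (QD e)); lra.
  rewrite poweRM//; last by rewrite lee_fin ltW.
  rewrite poweR_EFin => h; apply: (le_trans (lee_wpmul2l _ h)).
    by rewrite lee_fin mulr_ge0// ltW.
  by rewrite muleA -EFinM /tau mulrAC divfK// gt_eqF.
- apply: (@integral_packing _ _ _ gamma u u0 meas_u _ A _
      (fun i => cell (side 1 i.1) i.2)) => //.
  + by move=> i _; exact: measurable_cube.
  + by move=> i _; exact: measurable_cell.
  + exact: mFp.
  + by rewrite divr_ge0 ?powR_ge0// ltW// dilate_cst_gt0.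
  + move=> i /AG[lc Hi].
    have cube1 : cell (side (1 : R) i.1) i.2 `<=`
        cube (cell_center (side 1 i.1) i.2) (3 * side 1 i.1).
      apply: (subset_trans (cell_sub_cube (sd i.1))); apply: subset_cube => j.
      by rewrite subrr normr0; have := sd i.1; lra.
    apply: (@testing_dilate 1%R tau lam (cell_center (side 1 i.1) i.2)
      (3 * side 1 i.1)%R) => //.
    * by rewrite mulr_gt0.
    * by rewrite mul1r.
    * exact: measurable_cell.
Qed.

(** The side of these cubes is between a fixed multiple of the critical scale and
a times it, so cells whose side is proportional to that of the cubes have
bounded overlap, which the colouring turns into disjointness. *)
Lemma large_cubes a eps : (0 < a)%R -> (a < b)%R -> (0 < eps)%R ->
  exists2 C : R, (0 < C)%R & forall f lam, measurable_fun setT f ->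
    \int[gamma]_x (`|f x| `^ p * v x)%:E < +oo -> (0 < lam)%R ->
    exists W, [/\ measurable W,
      forall c l, local_cube a c l -> (eps < l * scale c)%R ->
        large_average f lam c l -> cube c l `<=` W &
      U W <= (C / lam `^ q)%:E *
        (\int[gamma]_x (`|f x| `^ p * v x)%:E) `^ (q / p)].
Proof.
move=> a0 ab eps0.
(* A cube of side l gets cells of side between eta l / 4 and eta l / 2: if they
   meet the cube, they fit into its dilation by b / a = 1 + eta.  The coarsest
   side S = eta a is large enough because l <= a. *)
pose eta : R := (b / a - 1)%R.
have eta0 : (0 < eta)%R by rewrite subr_gt0 ltr_pdivlMr// mul1r.
pose B : R := (2 + 2 * d%:R * (a / 2) ^+ 2)%R.
have B0 : (0 < B)%R.
  by have := mulr_ge0 (ler0n R d) (sqr_ge0 (a / 2)%R); rewrite /B; nra.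
pose S : R := (eta * a)%R.
have S0 : (0 < S)%R by rewrite mulr_gt0.
have sd k : (0 < side S k)%R by exact: side_gt0.
(* M bounds the ratio of the sides of two cells whose cubes share a point, and N
   the distance of their indices when the sides are equal. *)
pose M := Num.bound (2 * a * B ^+ 2 / eps)%R.
have hM : (2 * a * B ^+ 2 / eps <= M%:R)%R.
  apply/ltW/archi_boundP; rewrite divr_ge0 ?(ltW eps0)// mulr_ge0 ?sqr_ge0//.
  by rewrite mulr_ge0// ltW.
pose N := (Num.bound (8 / eta)%R).+1.
have hN : (8 / eta + 1 <= N%:R)%R.
  rewrite /N -[leRHS]natr1 lerD2r; apply/ltW/archi_boundP.
  by rewrite divr_ge0// ltW.
pose col := #|{: 'I_M.+1 * {ffun 'I_d -> 'I_N.+1}}|.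
have col0 : (0 < col)%N by apply/card_gt0P; exists (ord0, [ffun=> ord0]); rewrite inE.
exists (col%:R * dilate_cst (b / a) 1)%R.
  by rewrite mulr_gt0 ?ltr0n// dilate_cst_gt0// divr_gt0.
move=> f lam mf Foo lam0.
pose sel (i : nat * {ffun 'I_d -> int}) c l :=
  [/\ local_cube a c l, (eps < l * scale c)%R, large_average f lam c l,
    (eta * l / 4 <= side S i.1 < eta * l / 2)%R &
    cell (side S i.1) i.2 `&` cube c l !=set0].
pose A := [set i | exists c l, sel i c l].
have [g gP] : {g : nat * {ffun 'I_d -> int} -> (d.-tuple R) * R &
    forall i, A i -> sel i (g i).1 (g i).2}.
  apply: (@choice _ _ (fun i w => A i -> sel i w.1 w.2)) => i.
  have [[c [l h]]|nA] := pselect (A i); first by exists (c, l).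
  by exists (cell_center 0 i.2, 0%R).
pose Q i := cube (g i).1 (g i).2.
(* The side of a cell is comparable to the critical scale at every point of its
   cube. *)
have Qscale i z : A i -> Q i z ->
    (eta * eps / (4 * B) <= side S i.1 * scale z <= eta * B * a / 2)%R.
  move=> /gP; rewrite /Q; case: (g i) => c l /= [lc le _ /andP[s1 s2] _] zQ.
  have [l0 la] := (local_cubeE _ _ _).1 lc.
  have l2 : (l / 2 <= a / 2)%R by rewrite ler_pM2r// (local_cube_side lc).
  have zc : (scale z <= B * scale c)%R.
    by apply: scale_near => j; exact: le_trans (zQ j) l2.
  have cz : (scale c <= B * scale z)%R.
    by apply: scale_near => j; rewrite distrC; exact: le_trans (zQ j) l2.
  have sz := scale_gt0 z; have sc := scale_gt0 c.
  apply/andP; split.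
    rewrite ler_pdivrMr ?mulr_gt0//.
    apply: (@le_trans _ _ (eta * (l * scale c))%R).
      by rewrite ler_pM2l// ltW.
    apply: (@le_trans _ _ (eta * (l * (B * scale z)))%R).
      by rewrite ler_pM2l// ler_pM2l.
    rewrite [leLHS](_ : _ = (eta * l / 4) * (scale z * (4 * B)))%R; last by field.
    by rewrite -[leRHS]mulrA ler_wpM2r// mulr_ge0 ?mulr_ge0// ltW.
  apply: (@le_trans _ _ (eta * l / 2 * (B * scale c))%R).
    by apply: ler_pM => //; exact: ltW.
  rewrite [leLHS](_ : _ = eta * B / 2 * (l * scale c))%R; last by ring.
  rewrite [leRHS](_ : _ = eta * B / 2 * a)%R; last by ring.
  by rewrite ler_wpM2l// divr_ge0// mulr_ge0// ltW.
have Qside i j z : A i -> A j -> Q i z -> Q j z -> (side S i.1 <= M%:R * side S j.1)%R.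
  move=> Ai Aj Qi Qj; have sz := scale_gt0 z.
  have /andP[_ h1] := Qscale i z Ai Qi; have /andP[h2 _] := Qscale j z Aj Qj.
  rewrite -(ler_pM2r sz); apply: (le_trans h1); rewrite -[leRHS]mulrA.
  apply: (@le_trans _ _ (2 * a * B ^+ 2 / eps * (eta * eps / (4 * B)))%R).
    by rewrite le_eqVlt; apply/orP; left; apply/eqP; field; rewrite !gt_eqF.
  apply: ler_pM => //.
    by apply: divr_ge0; [apply: mulr_ge0 (sqr_ge0 _); apply: mulr_ge0|]; rewrite ?ltW.
  by apply: divr_ge0; apply: mulr_ge0; rewrite ?ltW.
have Qindex (i j : nat * {ffun 'I_d -> int}) (z : d.-tuple R) :
    A i -> A j -> Q i z -> Q j z -> i.1 = j.1 ->
    forall h : 'I_d, (`|i.2 h - j.2 h| <= N%:Z)%R.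
  move=> Ai Aj Qi Qj ij h.
  have [_ _ _ /andP[si _] [y [yi Qy]]] := gP i Ai.
  have [_ _ _ /andP[sj _] [y' [yj Qy']]] := gP j Aj.
  rewrite -ij in sj yj.
  rewrite -(@ler_int R) intr_norm rmorphB /=.
  apply: ltW; apply: lt_le_trans hN.
  apply: (@cell_index_dist R d (side S i.1) i.2 j.2 y y') => //.
  have l1 : ((g i).2 <= 4 / eta * side S i.1)%R.
    by rewrite mulrAC ler_pdivlMr//; lra.
  have l2 : ((g j).2 <= 4 / eta * side S i.1)%R.
    by rewrite mulrAC ler_pdivlMr//; lra.
  have -> : (8 / eta = 4 / eta + 4 / eta)%R by field; rewrite gt_eqF.
  have := Qy h; have := Qi h; have := Qy' h; have := Qj h.
  by rewrite mulrDl !ler_norml; lra.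
have tQ ch : trivIset (A `&` [set i | colour M N i = ch]) Q.
  move=> i j [Ai ci] [Aj cj] [z [zi zj]]; apply: (@colour_inj d M N).
  - by rewrite ci cj.
  - by apply: side_ratio S0 _; exact: Qside zj zi.
  - by apply: side_ratio S0 _; exact: Qside zi zj.
  - exact: Qindex zi zj.
have mP (i : nat * {ffun 'I_d -> int}) : measurable (cell (side S i.1) i.2).
  exact: measurable_cell.
exists (\bigcup_(i in A) cell (side S i.1) i.2); split.
- by apply: measurable_bigcup_countType => i _.
- move=> c l lc le la x xQ; have [l0 lb] := (local_cubeE _ _ _).1 lc.
  have t0 : (0 < eta * l / 4)%R by rewrite divr_gt0// mulr_gt0.
  have tS : (eta * l / 4 <= S)%R.
    have : (eta * l <= S)%R by rewrite ler_pM2l// (local_cube_side lc).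
    by have := mulr_gt0 eta0 l0; lra.
  have [k /andP[k1 k2]] := exists_side t0 tS.
  exists (k, cell_index (side S k) x); last exact: mem_cell_index.
  exists c, l; split => //=; first by rewrite k1 /=; lra.
  by exists x; split => //; exact: mem_cell_index.
- rewrite -mulrA EFinM -muleA.
  apply: (@integral_finite_cover_le _ _ _ gamma u u0 meas_u
    ('I_M.+1 * {ffun 'I_d -> 'I_N.+1})%type
    (fun ch => \bigcup_(i in A `&` [set i | colour M N i = ch]) cell (side S i.1) i.2)).
  + by apply: measurable_bigcup_countType => i _.
  + by move=> ch; apply: measurable_bigcup_countType => i _.
  + by move=> x [i Ai xi]; exists (colour M N i) => //; exists i.
  move=> ch; apply: (@integral_packing _ _ _ gamma u u0 meas_u _ _ _ Q) => //.
  + by move=> i _; exact: measurable_cube.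
  + exact: mFp.
  + by rewrite divr_ge0 ?powR_ge0// ltW// dilate_cst_gt0// divr_gt0.
  move=> i [Ai _]; have := gP i Ai; rewrite /Q; case: (g i) => c l /=.
  move=> [lc le la /andP[_ s2] [y [yi yQ]]]; have [l0 lb] := (local_cubeE _ _ _).1 lc.
  have ba0 : (0 < b / a)%R by rewrite divr_gt0.
  have etaE : (b / a * l = eta * l + l)%R by rewrite /eta; ring.
  have el0 : (0 < eta * l)%R by rewrite mulr_gt0.
  have sub : cube c l `<=` cube c (b / a * l).
    by apply: subset_cube => j; rewrite subrr normr0; lra.
  apply: (@le_trans _ _ (U (cube c (b / a * l)))).
    apply: ge0_subset_integral => //.
    - exact: measurable_cube.
    - by apply: measurable_funTS; exact/measurable_EFinP.
    - by move=> x _; rewrite lee_fin.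
    - move=> x xi j; have := yQ j; have := cell_dist j (sd i.1) xi yi.
      by rewrite !ler_norml; lra.
  apply: (@testing_dilate (b / a)%R 1%R lam c l) => //.
  + apply/local_cubeE; split; first by rewrite mulr_gt0.
    by rewrite -mulrA -[leRHS](divfK (lt0r_neq0 a0)) ler_pM2l.
  + exact: measurable_cube.
  + by rewrite mul1r ltW.
Qed.

End weak_type.

(** * The weak-type inequality *)

Section nonneg_weights.
Context {R : realType} {d : nat}.
Local Notation gamma := (gaussian R d).
Implicit Types (f u v : d.-tuple R -> R).
Local Open Scope ereal_scope.

Lemma maximal_gt a alpha f lam x : lam%:E < maximal a alpha f x ->
  exists c l, [/\ local_cube a c l, cube c l x & large_average alpha f lam c l].
Proof.
move=> /ereal_sup_gt[_ [c [l [lc xQ ->]]] H]; exists c, l; split => //.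
move: H; rewrite /large_average; have [g g0 ->] := gaussian_cubeE lc.
have gs0 : (0 < g `^ (1 - alpha / d%:R))%R by exact: powR_gt0.
by rewrite poweR_EFin inver gt_eqF// lte_pdivlMl// muleC.
Qed.

Lemma weak_type_nonneg K p q alpha a b u v :
  (0 < K)%R -> (1 <= p)%R -> (p <= q)%R -> (0 <= alpha)%R -> (alpha < d%:R)%R ->
  (0 < a)%R -> (a < b)%R ->
  measurable_fun setT u -> measurable_fun setT v ->
  (forall x, (0 <= u x)%R) -> (forall x, (0 <= v x)%R) ->
  testing K p q alpha b u v ->
  exists2 C : R, (0 < C)%R & forall f lam, measurable_fun setT f ->
    \int[gamma]_x (`|f x| `^ p * v x)%:E < +oo -> (0 < lam)%R ->
    exists W, [/\ measurable W,
      [set x | lam%:E < maximal a alpha f x] `<=` W &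
      \int[gamma]_(x in W) (u x)%:E <= (C / lam `^ q)%:E *
        (\int[gamma]_x (`|f x| `^ p * v x)%:E) `^ (q / p)].
Proof.
move=> K0 p1 pq alpha0 alphad a0 ab meas_u meas_v u0 v0 tst.
have b0 : (0 < b)%R by exact: lt_trans ab.
have [eps [C1 [eps0 C10 H1]]] := small_cubes K0 p1 pq alpha0 alphad b0 meas_u meas_v u0 v0 tst.
have [C2 C20 H2] := large_cubes K0 p1 pq alpha0 alphad b0 meas_u meas_v u0 v0 tst a0 ab eps0.
exists (2 * (C1 + C2))%R; first by rewrite mulr_gt0// addr_gt0.
move=> f lam mf Foo lam0.
have [W1 [mW1 W1P UW1]] := H1 f lam mf Foo lam0.
have [W2 [mW2 W2P UW2]] := H2 f lam mf Foo lam0.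
exists (W1 `|` W2); split; first exact: measurableU.
  move=> x /maximal_gt[c [l [lc xQ la]]].
  have [l0 lb] := (local_cubeE _ _ _).1 lc.
  case: (leP (l * scale c)%R eps) => le; [left|right].
    by apply: (W1P c l) => //; apply/local_cubeE.
  exact: (W2P c l).
rewrite -mulrA EFinM -muleA -card_bool.
apply: (@integral_finite_cover_le _ _ _ gamma u u0 meas_u bool
  (fun e => if e then W1 else W2)).
- exact: measurableU.
- by case.
- by move=> x [xW|xW]; [exists true|exists false].
- have l0 : (0 <= (lam `^ q)^-1)%R by rewrite invr_ge0 powR_ge0.
  case; [apply: (le_trans UW1)|apply: (le_trans UW2)];
    rewrite lee_wpmul2r ?poweR_ge0// lee_fin ler_wpM2r//.
  + by rewrite lerDl ltW.
  + by rewrite lerDr ltW.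
Qed.

Lemma integral_ae_eq_weights u u' (A : set (d.-tuple R)) : measurable A ->
  measurable_fun setT u -> measurable_fun setT u' ->
  {ae gamma, forall x, u x = u' x} ->
  \int[gamma]_(x in A) (u x)%:E = \int[gamma]_(x in A) (u' x)%:E.
Proof.
move=> mA meas_u meas_u' uu'; apply: ae_eq_integral => //.
- by apply: measurable_funTS; exact/measurable_EFinP.
- by apply: measurable_funTS; exact/measurable_EFinP.
by apply: filterS uu' => x -> _.
Qed.

(** Allows to replace the weights, which are nonnegative only almost everywhere, by
their positive parts. *)
Lemma muckenhoupt_ae_eq p q alpha b u v u' v' : (1 <= p)%R ->
  measurable_fun setT u -> measurable_fun setT v ->
  measurable_fun setT u' -> measurable_fun setT v' ->
  {ae gamma, forall x, u x = u' x} -> {ae gamma, forall x, v x = v' x} ->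
  muckenhoupt p q alpha b u v -> muckenhoupt p q alpha b u' v'.
Proof.
move=> p1 meas_u meas_v meas_u' meas_v' uu' vv'.
have avu c l : average (cube c l) (fun x => (u x)%:E) =
    average (cube c l) (fun x => (u' x)%:E).
  by rewrite /average (integral_ae_eq_weights (measurable_cube c l) meas_u meas_u' uu').
rewrite /muckenhoupt; have [_|pn1] := eqVneq p 1%R.
  rewrite /muckenhoupt_1; apply: le_lt_trans.
  apply: le_ereal_sup => _ [c [l [lc ->]]].
  exists c, l; split => //; rewrite -avu; apply/esym/eq_ess_sup.
  have [N [mN N0 hN]] := vv'; exists N; split => //.
    change (gamma (N `&` cube c l) = 0).
    have mNQ : measurable (N `&` cube c l).
      by apply: measurableI => //; exact: measurable_cube.
    exact: (subset_measure0 mNQ mN (@subIsetl _ _ _) N0).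
  by move=> x /= h; apply: hN => /= e; apply: h; rewrite e.
have r0 : (p / (p - 1) - 1 != 0)%R.
  have p10 : (0 < p - 1)%R by rewrite subr_gt0 lt_def pn1.
  by rewrite (_ : _ - 1 = (p - 1)^-1)%R ?invr_eq0 ?gt_eqF//; field; rewrite gt_eqF.
rewrite /muckenhoupt_gt1; apply: le_lt_trans.
apply: le_ereal_sup => _ [c [l [lc ->]]].
exists c, l; split => //; rewrite -avu; congr (_ * _ `^ _); rewrite /average; congr (_ * _).
have mQ := measurable_cube c l.
apply: ae_eq_integral => //.
- by apply: measurable_funTS; exact: measurable_poweR_inve.
- by apply: measurable_funTS; exact: measurable_poweR_inve.
by apply: filterS vv' => x -> _.
Qed.

End nonneg_weights.

Theorem theorem1p3 (R : realType) (d : nat) (a p q alpha : R)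
    (u v : d.-tuple R -> R) :
  0 < a -> 1 <= p -> p <= q -> 0 <= alpha -> alpha < d%:R ->
  weight u -> weight v ->
  (exists2 b : R, a < b & muckenhoupt p q alpha b u v) ->
  exists2 C : R, 0 < C &
    forall f : d.-tuple R -> R, weighted_Lp p v f -> forall lambda : R, 0 < lambda ->
      (\int[gaussian R d]_(x in [set x | lambda%:E < maximal a alpha f x])
         (u x)%:E
       <= (C / lambda `^ q)%:E *
          (\int[gaussian R d]_x (`|f x| `^ p * v x)%:E) `^ (q / p))%E.
Proof.
move=> a0 p1 pq alpha0 alphad [[meas_u _] u0] [[meas_v _] v0] [b ab muck].
pose pos (w : d.-tuple R -> R) x := Num.max (w x) 0.
have pos0 w x : 0 <= pos w x by rewrite le_max lexx orbT.
have mpos w : measurable_fun setT w -> measurable_fun setT (pos w).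
  by move=> mw; exact: measurable_maxr.
have aepos w : {ae gaussian R d, forall x, 0 <= w x} ->
    {ae gaussian R d, forall x, w x = pos w x}.
  by apply: filterS => x w0; rewrite /pos max_l.
have [K K0 tst] := muckenhoupt_testing p1 (lt_le_trans (lt_le_trans ltr01 p1) pq)
  (mpos _ meas_u) (mpos _ meas_v) (pos0 u) (pos0 v)
  (muckenhoupt_ae_eq p1 meas_u meas_v (mpos _ meas_u) (mpos _ meas_v)
     (aepos _ u0) (aepos _ v0) muck).
have [C C0 H] := weak_type_nonneg K0 p1 pq alpha0 alphad a0 ab
  (mpos _ meas_u) (mpos _ meas_v) (pos0 u) (pos0 v) tst.
exists C => // f [mf Foo] lambda lambda0.
have Fpos : (\int[gaussian R d]_x (`|f x| `^ p * v x)%:E =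
    \int[gaussian R d]_x (`|f x| `^ p * pos v x)%:E)%E.
  have mfp : measurable_fun setT (fun x => `|f x| `^ p).
    by apply: (measurableT_comp (measurable_powR _)); exact: measurableT_comp.
  apply: integral_ae_eq_weights => //.
  - exact: measurable_funM.
  - by apply: measurable_funM => //; exact: mpos.
  - by apply: filterS (aepos _ v0) => x <-.
rewrite Fpos in Foo *.
have [W [mW EW UW]] := H f lambda mf Foo lambda0.
apply: le_trans UW; apply: (le_trans (le_integral_superset _ _ EW)).
rewrite le_eqVlt; apply/orP; left; apply/eqP/eq_integral => x _.
by rewrite funeposE /pos EFin_max.
Qed.
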